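(* Let $\kappa>0$ and $\alpha\in(0,1)$. There exists a constant $C>0$ depending only on $\alpha$ and $\kappa$ such that for all integers $n,T\ge2$ and all $\tau\geq4\max\{\sqrt{10}\,\kappa,2\}\sqrt{3(n+T)}$, $$\sup_{M\in\mathcal{M}(\tau)}\mathbb{P}_{M}\left(|\hat{M}_{1,1}-M_{1,1}|>C\sqrt{n+T}/\tau\right)\leq\alpha ,$$ where $\hat M_{1,1}$ is the estimator $$\hat{M}_{1,1}=\frac{\hat{L}_{1}\hat{L}_{-1}'X_{-1,1}}{\|\hat{L}_{-1}\|_{2}^{2}}$$ defined in the context. (The supremum over an empty set is taken to be $0$.)
   Context: Model: $X=M+u$ where $M\in\mathbb{R}^{n\times T}$ is non-random and the entries $u_{i,t}$ of $u\in\mathbb{R}^{n\times T}$ are i.i.d. $N(0,1)$. The observed data is all entries of $X$ except the $(1,1)$ entry. $\mathbb{P}_M$ denotes probability when the mean matrix is $M$. For a matrix $A$, $\|A\|_\infty=\max_{i,j}|A_{i,j}|$ and $\sigma_1(A)\ge\sigma_2(A)\ge\cdots$ are its singular values. Define $\mathcal{M}=\{A\in\mathbb{R}^{n\times T}:\|A\|_\infty\le\kappa,\ \mathrm{rank}\,A\le2\}$ and $\mathcal{M}(\tau)=\{A\in\mathcal{M}:\sigma_1(A)\ge\tau,\ \sigma_2(A)=0\}$. Estimator: $X_{-1,1}=(X_{2,1},\dots,X_{n,1})'\in\mathbb{R}^{n-1}$. Let $W=(X_{i,t})_{1\le i\le n,\,2\le t\le T}\in\mathbb{R}^{n\times(T-1)}$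 be $X$ with its first column removed. $\hat L=(\hat L_1,\hat L_{-1}')'\in\mathbb{R}^n$ (with $\hat L_1\in\mathbb R$, $\hat L_{-1}\in\mathbb{R}^{n-1}$) is the one-factor PCA estimator of the loadings from $W$, i.e. a nonzero eigenvector of $WW'$ associated with its largest eigenvalue $\sigma_1(W)^2$; $\hat M_{1,1}$ does not depend on the scaling of $\hat L$. *)

(* Defs.v *)
From HB Require Import structures.
From mathcomp Require Import all_boot all_order all_algebra.
From mathcomp Require Import all_classical all_reals all_analysis.

Set Implicit Arguments.
Unset Strict Implicit.
Unset Printing Implicit Defensive.

Import Order.TTheory GRing.Theory Num.Theory.
Import numFieldNormedType.Exports.

Local Open Scope classical_set_scope.
Local Open Scope ring_scope.

Definition mutually_independent {d : measure_display} {Omega : measurableType d}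
    {R : realType} {P : probability Omega R} {I : finType}
    (X : I -> {RV P >-> R}) : Prop :=
  forall (J : {set I}) (B : I -> set R),
    (forall i, measurable (B i)) ->
    P (\bigcap_(i in [set` J]) (X i @^-1` B i)) =
    (\prod_(i in J) P (X i @^-1` B i))%E.

(* [normal_prob m s] is parametrised by the standard deviation [s]. *)
Definition iid_std_normal {d : measure_display} {Omega : measurableType d}
    {R : realType} {P : probability Omega R} {n T : nat}
    (u : 'I_n -> 'I_T -> {RV P >-> R}) : Prop :=
  mutually_independent (fun k : 'I_n * 'I_T => u k.1 k.2) /\
  forall (i : 'I_n) (t : 'I_T) (B : set R), measurable B ->
    distribution P (u i t) B = normal_prob 0 1 B.

(* [s] lists the singular values of [A] in nonincreasing order: the
   nonnegative square roots of the eigenvalues of [A *m A^T], counted with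
   multiplicity.  There are [n] of them; if [T < n], the last [n - T] are 0.
   Indexing starts at 0, so sigma_k(A) is [s`_(k.-1)].  Such an [s] exists by
   the spectral theorem and is unique. *)
Definition singular_values {R : realType} {n T : nat}
    (A : 'M[R]_(n, T)) (s : seq R) : Prop :=
  [/\ sorted >=%R s,
      all (fun x => 0 <= x) s
    & char_poly (A *m A^T) = \prod_(x <- s) ('X - (x ^+ 2)%:P)].

(* [mx_norm A] is the largest absolute value of the entries of [A]. *)
Definition Mclass {R : realType} (n T : nat) (kappa : R) : set 'M[R]_(n, T) :=
  [set A | mx_norm A <= kappa /\ (\rank A <= 2)%N].

Definition Mclass_tau {R : realType} (n T : nat) (kappa tau : R) :
    set 'M[R]_(n, T) :=
  [set A | Mclass kappa A /\
    exists2 s : seq R, singular_values A s & tau <= s`_0 /\ s`_1 = 0].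

(* The eigenvalues of the symmetric matrix [W *m W^T] for row vectors, to which
   [eigenvalue] refers, are also those for column vectors. *)
Definition pca_loading {R : realType} {n p : nat}
    (W : 'M[R]_(n, p)) (L : 'cV[R]_n) : Prop :=
  L != 0 /\
  exists2 lambda : R, W *m W^T *m L = lambda *: L
    & forall mu : R, eigenvalue (W *m W^T) mu -> mu <= lambda.

(* The sets of matrices that constrain one entry to a Borel set; they generate
   the Borel sigma-algebra of the space of matrices. *)
Definition entry_cylinders (R : realType) (n p : nat) :
    set (set 'M[R]_(n, p)) :=
  [set E | exists (i : 'I_n) (j : 'I_p) (B : set R),
    measurable B /\ E = [set A : 'M[R]_(n, p) | B (A i j)]].
Arguments entry_cylinders R n p : clear implicits.

Definition mx_measurable {R : realType} {n p q r : nat}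
    (f : 'M[R]_(n, p) -> 'M[R]_(q, r)) : Prop :=
  forall i j,
    measurable_fun [set: g_sigma_algebraType (entry_cylinders R n p)]
      (fun A : g_sigma_algebraType (entry_cylinders R n p) => f A i j).

Record pca_estimator {R : realType} {n p : nat}
    (Lhat : 'M[R]_(n, p) -> 'cV[R]_n) : Prop := PcaEstimator {
  pca_estimator_measurable : mx_measurable Lhat;
  pca_estimator_loading : forall W, pca_loading W (Lhat W) }.

(* The estimator of the entry [(i0, t0)].  [row' i0] and [col' t0] delete a row
   and a column, so the entry [X i0 t0] is not used.  By the convention
   [x / 0 = 0] the value is 0 if every loading except the [i0]-th vanishes. *)
Definition Mhat {R : realType} {n T : nat}
    (Lhat : 'M[R]_(n, T.-1) -> 'cV[R]_n) (i0 : 'I_n) (t0 : 'I_T)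
    (X : 'M[R]_(n, T)) : R :=
  let L := Lhat (col' t0 X) in
  L i0 0 * ((row' i0 L)^T *m row' i0 (col t0 X)) 0 0 /
    \sum_(i < n.-1) (row' i0 L i 0) ^+ 2.

(* Main.v *)
Require Import Defs.
From HB Require Import structures.
From mathcomp Require Import all_boot all_order all_algebra.
From mathcomp Require Import all_classical all_reals all_analysis.
From mathcomp Require Import measurable_realfun.
From mathcomp Require Import ring lra.
Import Order.TTheory GRing.Theory Num.Theory.
Import numFieldNormedType.Exports.

Set Implicit Arguments.
Unset Strict Implicit.
Unset Printing Implicit Defensive.

Local Open Scope classical_set_scope.
Local Open Scope ring_scope.

(** Write M = a *m G^T with a a unit vector. The data without the column t1 are
W = a *m F^T + E, where F is G without its entry t1 and E is Gaussian noise, and the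
estimator uses an eigenvector l of W *m W^T for the largest eigenvalue lam, that is, the
first left singular vector of W.

The operator norm of the noise is at most 5 sqrt (n + T) with overwhelming probability
(gaussian_opnorm), and the hypothesis on tau makes it smaller than 3/8 of the norm s of F.
On this event the error is controlled deterministically (entry_error). It has two parts.
The column noise contributes its product with l, and l is independent of it, so this is
bounded by a constant times the norm of l (loading_noise_tail). The rest is due to
the difference between l and a multiple of a. Its only delicate term is the noise e in the
row i1 along the right singular vector r = W^T *m l: relative to the norm of r, the
Cauchy-Schwarz inequality bounds it by sqrt (n + T) only, while a constant is needed, and r
depends on e. Therefore r is compared
with the singular vector r0 of the matrix in which the row i1 is replaced by 0. It is obtained
by applying the same estimator to that matrix, so it is a measurable function of data
independent of e, and the product of e with r0 is of the order of the norm of r0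
(left_out_row_noise_tail); the eigenvector equations show that r and r0 are close enough
(leave_one_out). All this is Mhat_error_tail, whose error probability is
q^(n + T) + 4 exp (- K^2 / 2) with q < 1.

For a given alpha, the first summand is small only when n + T is at least some m. When n + T < m
one has tau <= kappa * m, so that sqrt (n + T) / tau is bounded below and only tightness of
the error is needed (Mhat_error_bounded): the entries of the data are bounded with high
probability, and the denominator cannot be small compared with the entry i1 of l
unless the rows i1 and i2 of the data are nearly orthogonal, which is unlikely by a
small-ball estimate.

Independence of whole groups of entries is derived from the product rule by the pi-lambda
theorem (masks_independent); with Fubini's theorem it allows one group to be
held fixed (independent_section_bound), which turns the tail and small-ball estimates for
constant coefficients into estimates for coefficients that depend on the other entries. *)

(** * Independent groups of entries *)

Notation mxspace R n p := (g_sigma_algebraType (entry_cylinders R n p)).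

Lemma measurable_preimage (d d1 : measure_display) (S : measurableType d)
    (S1 : measurableType d1) (X : {mfun S >-> S1}) (A : set S1) :
  measurable A -> measurable (X @^-1` A).
Proof.
by move=> mA; rewrite -[X in measurable X]setTI; exact: measurable_funPT.
Qed.

(** The two sides are finite measures in A, so a generating pi-system decides. *)
Lemma indep_generated (R : realType) (d d1 : measure_display)
    (Omega : measurableType d) (P : probability Omega R)
    (S : measurableType d1) (X : {mfun Omega >-> S}) (G : set (set S))
    (E : set Omega) :
  measurable = <<s G >> -> setI_closed G -> G setT ->
  measurable E ->
  (forall A, G A -> P (X @^-1` A `&` E) = (P (X @^-1` A) * P E)%E) ->
  forall A, measurable A -> P (X @^-1` A `&` E) = (P (X @^-1` A) * P E)%E.
Proof.
move=> mG GI GT mE GE A mA.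
have mX : measurable_fun setT X by exact: measurable_funPT.
pose c := NngNum (fine_ge0 (measure_ge0 P E)).
have PE : (c%:num)%:E = P E by rewrite /= fineK// fin_num_measure.
pose m1 : {measure set S -> \bar R} := pushforward (mrestr P mE) X.
pose m2 : {measure set S -> \bar R} := mscale c (pushforward P X).
have m1E B : m1 mX B = P (X @^-1` B `&` E) by [].
have m2E B : m2 mX B = (P (X @^-1` B) * P E)%E by rewrite -PE muleC.
rewrite -m1E -m2E.
apply: (measure_unique G (fun=> setT)) => //.
- by rewrite bigcup_const.
- by move=> B GB; rewrite m1E m2E GE.
- move=> _; rewrite m1E ltey_eq fin_num_measure//.
  by apply: measurableI => //; rewrite preimage_setT.
Qed.

Lemma indep_generated2 (R : realType) (d d1 d2 : measure_display)
    (Omega : measurableType d) (P : probability Omega R)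
    (S1 : measurableType d1) (S2 : measurableType d2)
    (X : {mfun Omega >-> S1}) (Y : {mfun Omega >-> S2})
    (G : set (set S1)) (H : set (set S2)) :
  measurable = <<s G >> -> setI_closed G -> G setT ->
  measurable = <<s H >> -> setI_closed H -> H setT ->
  (forall A B, G A -> H B ->
     P (X @^-1` A `&` Y @^-1` B) = (P (X @^-1` A) * P (Y @^-1` B))%E) ->
  forall A B, measurable A -> measurable B ->
     P (X @^-1` A `&` Y @^-1` B) = (P (X @^-1` A) * P (Y @^-1` B))%E.
Proof.
move=> mG GI GT mH HI HT GH A B mA mB.
apply: (indep_generated (G := G)) => //; first exact: measurable_preimage.
move=> {mA} {}A GA; rewrite setIC muleC.
apply: (indep_generated (G := H)) => //.
  by apply: measurable_preimage; rewrite mG; exact: sub_gen_smallest.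
by move=> {mB} {}B HB; rewrite setIC muleC GH.
Qed.

(** Product formulas on rectangles pin down the joint law; Fubini's theorem can then
be used on functions of an independent pair. *)
Lemma joint_law (R : realType) (d d1 d2 : measure_display)
    (Omega : measurableType d) (P : probability Omega R)
    (S1 : measurableType d1) (S2 : measurableType d2)
    (X : {mfun Omega >-> S1}) (Y : {mfun Omega >-> S2}) :
  (forall A B, measurable A -> measurable B ->
     P (X @^-1` A `&` Y @^-1` B) = (P (X @^-1` A) * P (Y @^-1` B))%E) ->
  forall Q, measurable Q -> P [set w | Q (X w, Y w)] =
   (distribution P X \x distribution P Y)%E Q.
Proof.
move=> XY Q mQ.
have mXY : measurable_fun setT (fun w => (X w, Y w)).
  by apply/measurable_fun_pairP; split; exact: measurable_funPT.
pose m : {measure set (S1 * S2) -> \bar R} :=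
  pushforward P (fun w => (X w, Y w)).
rewrite (product_measure_unique (m' := m mXY))//.
Qed.

Lemma measurable_entry (R : realType) n p (i : 'I_n) (j : 'I_p) :
  measurable_fun [set: mxspace R n p] (fun A : mxspace R n p => A i j).
Proof.
move=> _ B mB; rewrite setTI; apply: sub_sigma_algebra.
by exists i, j, B.
Qed.

Lemma measurable_mx (R : realType) d (S : measurableType d) n p
    (f : S -> mxspace R n p) :
  (forall i j, measurable_fun setT (fun w => f w i j)) -> measurable_fun setT f.
Proof.
move=> mf; apply: (@measurability _ _ S (mxspace R n p) setT f (entry_cylinders R n p)) => //.
move=> _ [_ [i [j [B [mB ->]]]] <-].
exact: mf.
Qed.

Definition mx_rect (R : realType) n p (B : 'I_n -> 'I_p -> set R) :
    set (mxspace R n p) :=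
  [set A | forall i j, B i j (A i j)].

Definition mx_rects (R : realType) n p : set (set (mxspace R n p)) :=
  [set mx_rect B | B in [set B | forall i j, measurable (B i j)]].
Arguments mx_rects R n p : clear implicits.

(** The cylinders are not closed under intersection; the rectangles are, and they
generate the same sigma-algebra. *)
Lemma mx_rects_generate (R : realType) n p :
  measurable = <<s mx_rects R n p >> :> set (set (mxspace R n p)).
Proof.
apply/seteqP; split.
  apply: smallest_sub; first exact: smallest_sigma_algebra.
  move=> _ [i [j [B [mB ->]]]]; apply: sub_sigma_algebra.
  exists (fun i' j' => if (i' == i) && (j' == j) then B else setT).
    by move=> i' j'; case: ifP.
  apply/seteqP; split => [A /(_ i j)/=|A /= BA i' j']; first by rewrite !eqxx.
  by case: ifP => // /andP[/eqP-> /eqP->].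
apply: smallest_sub; first exact: sigma_algebra_measurable.
move=> _ [B mB <-].
rewrite (_ : mx_rect B = \bigcap_(i in [set: 'I_n]) \bigcap_(j in [set: 'I_p])
   ((fun A : mxspace R n p => A i j) @^-1` B i j)); last first.
  by apply/seteqP; split => [A BA i _ j _|A BA i j]; [exact: BA|exact: BA].
apply: fin_bigcap_measurable => // i _; apply: fin_bigcap_measurable => // j _.
by rewrite -[X in measurable X]setTI; exact: measurable_entry.
Qed.

Lemma mx_rects_setI (R : realType) n p : setI_closed (mx_rects R n p).
Proof.
move=> _ _ [B mB <-] [C mC <-]; exists (fun i j => B i j `&` C i j).
  by move=> i j; apply: measurableI.
apply/seteqP; split => [A BC|A [BA CA] i j]; last by split.
by split => i j; have [] := BC i j.
Qed.

Lemma mx_rects_setT (R : realType) n p : mx_rects R n p setT.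
Proof. by exists (fun _ _ => setT) => //; apply/seteqP; split. Qed.

(** Erasing entries, instead of extracting submatrices, keeps every group of entries
in one and the same measurable space. *)
Definition mask (R : realType) n p (J : {set 'I_n * 'I_p}) (A : 'M[R]_(n, p)) :
    mxspace R n p :=
  \matrix_(i, j) if (i, j) \in J then A i j else 0.

(** Independence of two disjoint groups of entries. It is enough to look at
rectangles, where it is the product rule: at each index one of the two conditions
is trivial. *)
Lemma masks_independent (R : realType) (d : measure_display)
    (Omega : measurableType d) (P : probability Omega R) n p
    (u : 'I_n -> 'I_p -> {RV P >-> R}) (J : {set 'I_n * 'I_p})
    (X Y : {mfun Omega >-> mxspace R n p}) :
  mutually_independent (fun k : 'I_n * 'I_p => u k.1 k.2) ->
  X = (fun w => mask (~: J) (\matrix_(i, j) u i j w)) :> (Omega -> _) ->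
  Y = (fun w => mask J (\matrix_(i, j) u i j w)) :> (Omega -> _) ->
  forall A B, measurable A -> measurable B ->
     P (X @^-1` A `&` Y @^-1` B) = (P (X @^-1` A) * P (Y @^-1` B))%E.
Proof.
move=> ind XE YE; apply: (indep_generated2 (G := mx_rects R n p)
  (H := mx_rects R n p)).
- exact: mx_rects_generate.
- exact: mx_rects_setI.
- exact: mx_rects_setT.
- exact: mx_rects_generate.
- exact: mx_rects_setI.
- exact: mx_rects_setT.
move=> _ _ [B mB <-] [C mC <-].
(* The masked matrix lies in a rectangle iff every entry of the full matrix lies
   in a set of its own: the side of the rectangle at a kept entry, and the whole
   line or nothing at an erased one. *)
pose part (K : {set 'I_n * 'I_p}) (D : 'I_n -> 'I_p -> set R) k : set R :=
  if k \in K then D k.1 k.2 else if 0 \in D k.1 k.2 then setT else set0.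
have mpart K D k : (forall i j, measurable (D i j)) -> measurable (part K D k).
  by move=> mD; rewrite /part; case: ifP => // _; case: ifP.
have probE (D : 'I_n * 'I_p -> set R) : (forall k, measurable (D k)) ->
    P [set w | forall k, D k (u k.1 k.2 w)] =
    (\prod_k P (u k.1 k.2 @^-1` D k))%E.
  move=> mD; have := ind [set: 'I_n * 'I_p]%SET D mD.
  under [in RHS]eq_bigl do rewrite inE.
  move=> <-; congr (P _); apply/seteqP; split => w /= H.
    by move=> k _; exact: H.
  by move=> k; apply: (H k); rewrite /= inE.
have maskE K D w : mx_rect D (mask K (\matrix_(i, j) u i j w)) <->
    forall k, part K D k (u k.1 k.2 w).
  split=> [H [i j]|H i j].
    have := H i j; rewrite /part /mask !mxE/=; case: ifP => // _ D0.
    by rewrite mem_set.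
  have := H (i, j); rewrite /part /mask !mxE/=; case: ifP => // _.
  by case: ifP => // /set_mem.
have EX : X @^-1` mx_rect B = [set w | forall k, part (~: J) B k (u k.1 k.2 w)].
  by rewrite XE; apply/seteqP; split => w /= /maskE.
have EY : Y @^-1` mx_rect C = [set w | forall k, part J C k (u k.1 k.2 w)].
  by rewrite YE; apply/seteqP; split => w /= /maskE.
rewrite EX EY !probE; [|by move=> k; exact: mpart..].
rewrite (_ : _ `&` _ = [set w | forall k,
    (part (~: J) B k `&` part J C k) (u k.1 k.2 w)]); last first.
  apply/seteqP; split => [w [H K] k|w /= H]; first by split.
  by split => k; have [] := H k.
rewrite (probE (fun k => part (~: J) B k `&` part J C k)); last first.
  by move=> k; apply: measurableI; exact: mpart.
rewrite -big_split/=; apply: eq_bigr => k _; rewrite /part inE.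
have P0 : P (u k.1 k.2 @^-1` set0) = 0%E by rewrite preimage_set0 measure0.
have PT : P (u k.1 k.2 @^-1` setT) = 1%E by rewrite preimage_setT probability_setT.
case: (boolP (k \in J)) => kJ /=; case: ifP => _.
- by rewrite setTI PT mul1e.
- by rewrite set0I P0 mul0e.
- by rewrite setIT PT mule1.
- by rewrite setI0 P0 mule0.
Qed.

(** * Gaussian linear forms *)

Lemma ge0_integral_joint (R : realType) (d d1 d2 : measure_display)
    (Omega : measurableType d) (P : probability Omega R)
    (S1 : measurableType d1) (S2 : measurableType d2)
    (X : {mfun Omega >-> S1}) (Y : {mfun Omega >-> S2})
    (F : S1 * S2 -> \bar R) :
  (forall A B, measurable A -> measurable B ->
     P (X @^-1` A `&` Y @^-1` B) = (P (X @^-1` A) * P (Y @^-1` B))%E) ->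
  measurable_fun [set: S1 * S2] F -> (forall z, 0 <= F z)%E ->
  (\int[P]_w F (X w, Y w) = \int[P]_v \int[P]_w F (X v, Y w))%E.
Proof.
move=> XY mF F0.
have mXY : measurable_fun setT (fun w => (X w, Y w)).
  by apply/measurable_fun_pairP; split; exact: measurable_funPT.
pose m : {measure set (S1 * S2) -> \bar R} :=
  pushforward P (fun w => (X w, Y w)).
transitivity (\int[m mXY]_z F z)%E.
  by rewrite ge0_integral_pushforward//= preimage_setT.
rewrite (eq_measure_integral (distribution P X \x distribution P Y)%E); last first.
  by move=> A mA _; exact: joint_law.
rewrite fubini_tonelli1// ge0_integral_distribution//=.
- apply: eq_integral => v _ /=; rewrite /fubini_F ge0_integral_distribution//.
  by apply: measurableT_comp => //; exact: pair1_measurable.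
- exact: measurable_fun_fubini_tonelli_F.
- by move=> x; exact: integral_ge0.
Qed.

(** The density of the standard normal law times exp (t x) is exp (t^2 / 2) times the
density of the normal law with mean t. *)
Lemma normal_mgf (R : realType) (t : R) :
  (\int[normal_prob 0 1]_x (expR (t * x))%:E = (expR (t ^+ 2 / 2))%:E)%E.
Proof.
pose mu : {sigma_finite_measure set _ -> \bar R} := (@lebesgue_measure R).
pose nu : {finite_measure set _ -> \bar R} := (@normal_prob R 0 1).
have dom : nu `<< mu by exact: normal_prob_dominates.
have mexp : measurable_fun [set: R] (fun x => (expR (t * x))%:E).
  apply/measurable_EFinP; apply: measurableT_comp => //.
rewrite -(Radon_Nikodym_SigmaFinite.change_of_variables dom)//.
(* The derivative is only known up to null sets, and agrees there with the
   Gaussian density. *)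
have ae : ae_eq mu setT (Radon_Nikodym_SigmaFinite.f nu mu)
    (fun x => (normal_pdf 0 1 x)%:E).
  apply: integral_ae_eq => //.
  - exact: (Radon_Nikodym_SigmaFinite.f_integrable dom).
  - by apply/measurable_EFinP; exact: measurable_normal_pdf.
  - by move=> E _ mE; rewrite -(Radon_Nikodym_SigmaFinite.f_integral dom).
transitivity (\int[mu]_x ((expR (t * x))%:E * (normal_pdf 0 1 x)%:E))%E.
  apply: ae_eq_integral => //.
  - apply: emeasurable_funM => //.
    exact: measurable_int (Radon_Nikodym_SigmaFinite.f_integrable dom).
  - apply: emeasurable_funM => //.
    by apply/measurable_EFinP; exact: measurable_normal_pdf.
  - exact: ae_eqe_mul2l.
(* Completing the square turns the tilted density into the density centred at
   t. *)
transitivity (\int[mu]_x ((expR (t ^+ 2 / 2))%:E * (normal_pdf t 1 x)%:E))%E.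
  apply: eq_integral => x _; rewrite -!EFinM !normal_pdfE ?oner_neq0//.
  congr (_%:E); rewrite /normal_fun mulrCA [RHS]mulrCA -!expRD; congr (_ * expR _).
  by field.
rewrite ge0_integralZl ?integral_normal_pdf ?mule1//.
- by apply/measurable_EFinP; exact: measurable_normal_pdf.
- by move=> x _; rewrite lee_fin normal_pdf_ge0.
Qed.

Lemma iid_integral (R : realType) (d : measure_display)
    (Omega : measurableType d) (P : probability Omega R) n p
    (u : 'I_n -> 'I_p -> {RV P >-> R}) i j (f : R -> \bar R) :
  iid_std_normal u -> measurable_fun setT f -> (forall x, 0 <= f x)%E ->
  (\int[P]_w f (u i j w) = \int[normal_prob 0 1]_x f x)%E.
Proof.
move=> [_ law] mf f0.
pose v : Omega -> measurableTypeR R := u i j.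
have mv : measurable_fun setT v.
  by move=> _ B mB; exact: (@measurable_funPT _ _ _ _ (u i j)).
pose m : {measure set (measurableTypeR R) -> \bar R} := pushforward P v.
transitivity (\int[m mv]_x f x)%E.
  by rewrite ge0_integral_pushforward.
by apply: eq_measure_integral => A mA _; exact: law.
Qed.

Lemma mask_mfun (R : realType) (d : measure_display)
    (Omega : measurableType d) (P : probability Omega R) n p
    (u : 'I_n -> 'I_p -> {RV P >-> R}) (J : {set 'I_n * 'I_p}) :
  exists X : {mfun Omega >-> mxspace R n p},
    X = (fun w => mask J (\matrix_(i, j) u i j w)) :> (Omega -> _).
Proof.
have mX : measurable_fun setT (fun w => mask J (\matrix_(i, j) u i j w)).
  apply: measurable_mx => i j; rewrite /mask.
  under eq_fun do rewrite !mxE.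
  by case: ((i, j) \in J); [exact: measurable_funPT|exact: measurable_cst].
by exists (mfun_Sub (mem_set mX)).
Qed.

(** By induction on the list of indices, one entry at a time being split off as an
independent factor. *)
Lemma gauss_linear_mgf (R : realType) (d : measure_display)
    (Omega : measurableType d) (P : probability Omega R) n p
    (u : 'I_n -> 'I_p -> {RV P >-> R}) (c : 'I_n * 'I_p -> R)
    (r : seq ('I_n * 'I_p)) :
  iid_std_normal u -> uniq r ->
  (\int[P]_w (expR (\sum_(k <- r) c k * u k.1 k.2 w))%:E =
   (expR (\sum_(k <- r) c k ^+ 2 / 2))%:E)%E.
Proof.
move=> iid; elim: r => [_|k r IH /= /andP[kr ur]].
  under eq_integral do rewrite big_nil expR0.
  by rewrite big_nil expR0 integral_cst//= probability_setT mule1.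
have [X XE] := mask_mfun u (~: [set k]); have [Y YE] := mask_mfun u [set k].
have ind := masks_independent (proj1 iid) XE YE.
pose F (z : mxspace R n p * mxspace R n p) : \bar R :=
  (expR (\sum_(j <- r) c j * z.1 j.1 j.2) * expR (c k * z.2 k.1 k.2))%:E.
have FE v w : F (X v, Y w) = ((expR (\sum_(j <- r) c j * u j.1 j.2 v))%:E *
    (expR (c k * u k.1 k.2 w))%:E)%E.
  rewrite /F -EFinM XE YE /mask/= !mxE -!surjective_pairing inE eqxx.
  congr (expR _ * _)%:E; rewrite !big_seq; apply: eq_bigr => j jr.
  rewrite !mxE -!surjective_pairing !inE.
  by case: eqP => // jk; rewrite -jk jr in kr.
have mF : measurable_fun setT F.
  apply/measurable_EFinP/measurable_funM.
    apply: measurableT_comp => //; apply: measurable_sum => j.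
    apply: measurable_funM => //; apply: (measurableT_comp (measurable_entry j.1 j.2)).
    exact: measurable_fst.
  apply: measurableT_comp => //.
  apply: measurable_funM => //; apply: (measurableT_comp (measurable_entry k.1 k.2)).
  exact: measurable_snd.
have F0 z : (0 <= F z)%E by rewrite lee_fin mulr_ge0// expR_ge0.
transitivity (\int[P]_w F (X w, Y w))%E.
  by apply: eq_integral => w _; rewrite FE -EFinM -expRD big_cons addrC.
have mu j : measurable_fun setT (fun w => (expR (c j * u j.1 j.2 w))%:E).
  apply/measurable_EFinP/measurableT_comp => //; exact: measurable_funM.
have e0 (x : R) : (0 <= (expR x)%:E)%E by rewrite lee_fin expR_ge0.
have mexp t : measurable_fun [set: R] (fun x => (expR (t * x))%:E).
  apply/measurable_EFinP; apply: measurableT_comp => //.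
rewrite (ge0_integral_joint ind mF F0).
under eq_integral => v _.
  under eq_integral do rewrite FE.
  rewrite ge0_integralZl//.
  rewrite (iid_integral k.1 k.2 iid (f := fun x => (expR (c k * x))%:E))//.
  rewrite normal_mgf.
  over.
rewrite ge0_integralZr//; last first.
  apply/measurable_EFinP/measurableT_comp => //; apply: measurable_sum => j.
  exact: measurable_funM.
by rewrite IH// big_cons -EFinM -expRD addrC.
Qed.

Lemma measurable_set_lt (R : realType) d (S : measurableType d) (f g : S -> R) :
  measurable_fun setT f -> measurable_fun setT g ->
  measurable [set x | f x < g x].
Proof.
move=> mf mg; rewrite -[X in measurable X]setTI.
rewrite (_ : [set _ | _] = [set x | (EFin \o f) x < (EFin \o g) x]%E); last first.
  by apply/seteqP; split => x; rewrite /= lte_fin.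
by apply: measurable_lte => //; apply/measurable_EFinP.
Qed.

Lemma measurable_set_le (R : realType) d (S : measurableType d) (f g : S -> R) :
  measurable_fun setT f -> measurable_fun setT g ->
  measurable [set x | f x <= g x].
Proof.
move=> mf mg; rewrite (_ : [set _ | _] = ~` [set x | g x < f x]).
  exact/measurableC/measurable_set_lt.
by apply/seteqP; split => x /=; rewrite leNgt => /negP.
Qed.

Lemma measurable_abs (R : realType) d (S : measurableType d) (f : S -> R) :
  measurable_fun setT f -> measurable_fun setT (fun x => `|f x|).
Proof. by move=> mf; exact: (measurableT_comp (@normr_measurable R setT)). Qed.

Lemma measurable_sum_in (R : realType) d (S : measurableType d) (I : finType)
    (J : {set I}) (h : I -> S -> R) :
  (forall k, measurable_fun setT (h k)) ->
  measurable_fun setT (fun x => \sum_(k in J) h k x).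
Proof.
move=> mh; under eq_fun do rewrite -big_enum/=.
exact: measurable_sum.
Qed.

(** An event on two independent groups of entries is as unlikely as its sections: the
first group may be held fixed. *)
Lemma independent_section_bound (R : realType) (d : measure_display)
    (Omega : measurableType d) (P : probability Omega R) n p
    (u : 'I_n -> 'I_p -> {RV P >-> R}) (J : {set 'I_n * 'I_p})
    (Q : set (mxspace R n p * mxspace R n p)) (beta : R) :
  iid_std_normal u -> measurable Q ->
  (forall A, P [set w | Q (A, mask J (\matrix_(i, j) u i j w))] <= beta%:E)%E ->
  (P [set w | Q (mask (~: J) (\matrix_(i, j) u i j w),
                 mask J (\matrix_(i, j) u i j w))] <= beta%:E)%E.
Proof.
move=> [ind _] mQ Qbeta.
have [X XE] := mask_mfun u (~: J); have [Y YE] := mask_mfun u J.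
have XY := masks_independent ind XE YE.
rewrite (_ : [set w | _] = [set w | Q (X w, Y w)]); last by rewrite XE YE.
rewrite (joint_law XY mQ).
apply: (@le_trans _ _ (\int[distribution P X]_x beta%:E)%E).
  apply: ge0_le_integral => //.
  - exact: measurable_fun_xsection.
  - move=> A _; have := Qbeta A.
    by rewrite /distribution /pushforward /= YE /xsection/=;
       congr (P _ <= _)%E; apply/seteqP; split=> w /=; rewrite inE.
by rewrite integral_cst//= probability_setT mule1.
Qed.

(** Chernoff's bound with the moment generating function of a linear form. *)
Lemma gauss_tail (R : realType) (d : measure_display)
    (Omega : measurableType d) (P : probability Omega R) n p
    (u : 'I_n -> 'I_p -> {RV P >-> R}) (c : 'I_n * 'I_p -> R)
    (J : {set 'I_n * 'I_p}) (v t : R) :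
  iid_std_normal u -> 0 < v -> \sum_(k in J) c k ^+ 2 <= v -> 0 <= t ->
  (P [set w | (t <= \sum_(k in J) c k * u k.1 k.2 w)%R] <=
   (expR (- (t ^+ 2 / (2 * v))))%:E)%E.
Proof.
move=> iid v0 cv; rewrite le_eqVlt => /predU1P[<-|t0].
  by rewrite expr0n/= mul0r oppr0 expR0 probability_le1//;
     apply: measurable_set_le => //; apply: measurable_sum_in => k;
     exact: measurable_funM.
have mX : measurable_fun setT (fun w => \sum_(k in J) c k * u k.1 k.2 w).
  by apply: measurable_sum_in => k; exact: measurable_funM.
pose X : {RV P >-> R} := mfun_Sub (mem_set mX).
(* t / v is the optimal parameter in Chernoff's bound. *)
have tv : 0 < t / v by rewrite divr_gt0.
have := chernoff X t tv; rewrite [X in (_ <= X * _)%E]/mmt_gen_fun expectation_def/=.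
move=> /le_trans; apply.
have := @gauss_linear_mgf R d Omega P n p u (fun k => t / v * c k) (enum J) iid (enum_uniq _).
rewrite [X in _ -> (X * _ <= _)%E](_ : _ = \int[P]_w (expR (\sum_(k <- enum J) t / v * c k * u k.1 k.2 w))%:E)%E; last first.
  apply: eq_integral => w _; congr (expR _)%:E; rewrite big_enum/= mulr_suml.
  by apply: eq_bigr => k _; rewrite mulrC mulrA.
move=> ->; rewrite -EFinM -expRD lee_fin ler_expR big_enum/=.
have -> : \sum_(k in J) (t / v * c k) ^+ 2 / 2 =
    (t / v) ^+ 2 / 2 * \sum_(k in J) c k ^+ 2.
  by rewrite mulr_sumr; apply: eq_bigr => k _; rewrite exprMn mulrAC.
have -> : - (t ^+ 2 / (2 * v)) = (t / v) ^+ 2 / 2 * v - t / v * t.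
  by field; rewrite gt_eqF.
by rewrite lerD2r ler_wpM2l// divr_ge0// sqr_ge0.
Qed.

Lemma gauss_tail_abs (R : realType) (d : measure_display)
    (Omega : measurableType d) (P : probability Omega R) n p
    (u : 'I_n -> 'I_p -> {RV P >-> R}) (c : 'I_n * 'I_p -> R)
    (J : {set 'I_n * 'I_p}) (K : R) :
  iid_std_normal u -> 0 <= K ->
  (P [set w | (K * Num.sqrt (\sum_(k in J) c k ^+ 2) <
       `|\sum_(k in J) c k * u k.1 k.2 w|)%R] <=
   (2 * expR (- (K ^+ 2 / 2)))%:E)%E.
Proof.
move=> iid K0; set v := \sum_(k in J) c k ^+ 2.
have : 0 <= v by apply: sumr_ge0 => k _; exact: sqr_ge0.
rewrite le_eqVlt => /predU1P[v0|v0].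
  rewrite (_ : [set w | _] = set0) ?measure0.
    by rewrite lee_fin mulr_ge0// expR_ge0.
  apply/seteqP; split => // w /=; rewrite big1 ?normr0 => [|k kJ].
    by rewrite ltNge mulr_ge0// sqrtr_ge0.
  apply/eqP; rewrite mulf_eq0; apply/orP; left; rewrite -sqrf_eq0.
  move/esym/eqP: v0; rewrite psumr_eq0 => [/allP/(_ k)|j _]; last exact: sqr_ge0.
  by rewrite mem_index_enum kJ => /(_ isT).
have s0 : 0 < Num.sqrt v by rewrite sqrtr_gt0.
have mS (a : R) : measurable_fun setT
    (fun w => \sum_(k in J) (a * c k) * u k.1 k.2 w).
  by apply: measurable_sum_in => k; exact: measurable_funM.
pose tail a := [set w | K * Num.sqrt v <=
  \sum_(k in J) (a * c k) * u k.1 k.2 w].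
have mtail a : measurable (tail a) by exact: measurable_set_le.
have Ptail a : a ^+ 2 = 1 -> (P (tail a) <= (expR (- (K ^+ 2 / 2)))%:E)%E.
  move=> a1; have := @gauss_tail _ _ _ P _ _ u (fun k => a * c k) J v
    (K * Num.sqrt v) iid v0.
  rewrite (_ : (K * Num.sqrt v) ^+ 2 / (2 * v) = K ^+ 2 / 2); last first.
    by rewrite exprMn sqr_sqrtr ?ltW//; field; rewrite gt_eqF.
  apply; last by rewrite mulr_ge0// ltW.
  by under eq_bigr do rewrite exprMn a1 mul1r.
apply: (@le_trans _ _ (P (tail 1 `|` tail (-1)))).
  apply: le_measure; rewrite ?inE; [|exact: measurableU|].
    apply: measurable_set_lt => //; apply: measurable_abs.
    by apply: measurable_sum_in => k; exact: measurable_funM.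
  move=> w /=; rewrite /tail/= ltr_normr => /orP[] /ltW H; [left|right].
    by under eq_bigr do rewrite mul1r.
  by under eq_bigr do rewrite mulN1r mulNr; rewrite sumrN.
apply: (le_trans (measureU2 _ _ _)) => //.
rewrite mulr_natl mulr2n EFinD; apply: leeD; apply: Ptail.
  exact: expr1n.
by rewrite sqrrN expr1n.
Qed.

(** Coefficients that depend only on the entries outside J are constants once these
entries are held fixed, so the tail does not deteriorate with the number of entries in
J. The noise in directions computed from the data is controlled by this lemma. *)
Lemma gauss_tail_random (R : realType) (d : measure_display)
    (Omega : measurableType d) (P : probability Omega R) n p
    (u : 'I_n -> 'I_p -> {RV P >-> R}) (J : {set 'I_n * 'I_p})
    (c : 'I_n * 'I_p -> mxspace R n p -> R) (K : R) :
  iid_std_normal u -> 0 <= K -> (forall k, measurable_fun setT (c k)) ->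
  (P [set w | let A := mask (~: J) (\matrix_(i, j) u i j w) in
      (K * Num.sqrt (\sum_(k in J) c k A ^+ 2) <
       `|\sum_(k in J) c k A * u k.1 k.2 w|)%R] <=
   (2 * expR (- (K ^+ 2 / 2)))%:E)%E.
Proof.
move=> iid K0 mc; pose A w := mask (~: J) (\matrix_(i, j) u i j w).
pose Q : set (mxspace R n p * mxspace R n p) := [set z |
  K * Num.sqrt (\sum_(k in J) c k z.1 ^+ 2) <
  `|\sum_(k in J) c k z.1 * (z.2 : 'M[R]_(n, p)) k.1 k.2|].
have mQ : measurable Q.
  have mc1 k : measurable_fun [set: mxspace R n p * mxspace R n p]
      (fun z : mxspace R n p * mxspace R n p => c k z.1).
    by apply: measurableT_comp => //; exact: measurable_fst.
  apply: measurable_set_lt.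
    apply: measurable_funM => //.
    apply: (measurableT_comp (f := @Num.sqrt R)).
      exact: continuous_measurable_fun (@sqrt_continuous R).
    by apply: measurable_sum_in => k; exact: measurable_funX.
  apply: measurable_abs; apply: measurable_sum_in => k.
  apply: measurable_funM => //.
  by apply: (measurableT_comp (measurable_entry k.1 k.2)); exact: measurable_snd.
have entry w k : k \in J -> mask J (\matrix_(i, j) u i j w) k.1 k.2 = u k.1 k.2 w.
  by move=> kJ; rewrite /mask !mxE -surjective_pairing kJ.
have QE a w : Q (a, mask J (\matrix_(i, j) u i j w)) =
    (K * Num.sqrt (\sum_(k in J) c k a ^+ 2) <
     `|\sum_(k in J) c k a * u k.1 k.2 w|) :> Prop.
  rewrite /Q/=; congr (is_true (_ < `|_|)).
  by apply: eq_bigr => k kJ; rewrite entry.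
rewrite /= (_ : [set w | _] = [set w | Q (A w, mask J (\matrix_(i, j) u i j w))]).
  apply: independent_section_bound => // a.
  by under eq_set do rewrite QE; exact: gauss_tail_abs.
by apply: eq_set => w; rewrite QE.
Qed.

(** The normal density is at most 1 / sqrt (2 pi), hence at most 1/2. *)
Lemma normal_small_ball (R : realType) (d : measure_display)
    (Omega : measurableType d) (P : probability Omega R) n p
    (u : 'I_n -> 'I_p -> {RV P >-> R}) i j (b eta : R) :
  iid_std_normal u -> 0 <= eta ->
  (P [set w | (`|u i j w + b| <= eta)%R] <= eta%:E)%E.
Proof.
move=> [_ law] eta0.
rewrite (_ : [set w | _] = u i j @^-1` `[- b - eta, - b + eta]); last first.
  apply/seteqP; split => w; rewrite /= in_itv/= ler_norml => /andP[? ?];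
  by apply/andP; split; lra.
rewrite [leLHS](_ : _ = normal_prob 0 1 `[- b - eta, - b + eta]); last first.
  exact: (law i j).
rewrite /normal_prob.
apply: (@le_trans _ _ (\int[lebesgue_measure]_(x in `[(- b - eta)%R, (- b + eta)%R])
   (2^-1)%R%:E)%E).
  apply: ge0_le_integral => //.
  - by move=> x _; rewrite lee_fin normal_pdf_ge0.
  - by apply/measurable_EFinP/measurable_funTS; exact: measurable_normal_pdf.
  - move=> x _; rewrite lee_fin (le_trans (normal_pdf_ub _ _ (oner_neq0 _)))//.
    rewrite /normal_peak lef_pV2 ?posrE ?sqrtr_gt0 ?expr1n ?mul1r//; last first.
      by rewrite mulrn_wgt0// pi_gt0.
    rewrite -[leLHS]ger0_norm// -sqrtr_sqr ler_sqrt.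
      by rewrite -mulr_natr; have := pi_ge2 R; lra.
    by rewrite mulrn_wge0// pi_ge0.
rewrite integral_cst//= lebesgue_measure_itv/= lte_fin.
case: ifP => _; last by rewrite mule0 lee_fin.
by rewrite -EFinB -EFinM lee_fin; lra.
Qed.

(** * Euclidean geometry of column vectors *)

Definition dot (R : realType) n (x y : 'cV[R]_n) : R := \sum_i x i 0 * y i 0.

Definition nrm (R : realType) n (x : 'cV[R]_n) : R := Num.sqrt (dot x x).

Lemma dotE (R : realType) n (x y : 'cV[R]_n) : (x^T *m y) 0 0 = dot x y.
Proof. by rewrite mxE; apply: eq_bigr => i _; rewrite mxE. Qed.

Lemma dotC (R : realType) n (x y : 'cV[R]_n) : dot x y = dot y x.
Proof. by apply: eq_bigr => i _; rewrite mulrC. Qed.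

Lemma dotDr (R : realType) n (x y z : 'cV[R]_n) :
  dot x (y + z) = dot x y + dot x z.
Proof. by rewrite -big_split/=; apply: eq_bigr => i _; rewrite mxE mulrDr. Qed.

Lemma dotZr (R : realType) n a (x y : 'cV[R]_n) : dot x (a *: y) = a * dot x y.
Proof. by rewrite mulr_sumr; apply: eq_bigr => i _; rewrite mxE mulrCA. Qed.

Lemma dotNr (R : realType) n (x y : 'cV[R]_n) : dot x (- y) = - dot x y.
Proof. by rewrite -scaleN1r dotZr mulN1r. Qed.

Lemma dotBr (R : realType) n (x y z : 'cV[R]_n) :
  dot x (y - z) = dot x y - dot x z.
Proof. by rewrite dotDr dotNr. Qed.

Lemma dotDl (R : realType) n (x y z : 'cV[R]_n) :
  dot (x + y) z = dot x z + dot y z.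
Proof. by rewrite dotC dotDr ![dot z _]dotC. Qed.

Lemma dotZl (R : realType) n a (x y : 'cV[R]_n) : dot (a *: x) y = a * dot x y.
Proof. by rewrite dotC dotZr dotC. Qed.

Lemma dotBl (R : realType) n (x y z : 'cV[R]_n) :
  dot (x - y) z = dot x z - dot y z.
Proof. by rewrite dotC dotBr ![dot z _]dotC. Qed.

Lemma dot0r (R : realType) n (x : 'cV[R]_n) : dot x 0 = 0.
Proof. by rewrite -(scale0r 0) dotZr mul0r. Qed.

Lemma dot_mulmx (R : realType) n p (A : 'M[R]_(n, p)) x y :
  dot x (A *m y) = dot (A^T *m x) y.
Proof. by rewrite -!dotE trmx_mul trmxK mulmxA. Qed.

Lemma dot_ge0 (R : realType) n (x : 'cV[R]_n) : 0 <= dot x x.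
Proof. by apply: sumr_ge0 => i _; rewrite -expr2 sqr_ge0. Qed.

Lemma dot_eq0 (R : realType) n (x : 'cV[R]_n) : (dot x x == 0) = (x == 0).
Proof.
apply/eqP/eqP => [x0|->]; last by rewrite dot0r.
apply/colP => i; rewrite mxE; apply/eqP; rewrite -sqrf_eq0 expr2.
move/eqP: x0; rewrite psumr_eq0 => [/allP/(_ i)|j _].
  by rewrite mem_index_enum => /(_ isT).
by rewrite -expr2 sqr_ge0.
Qed.

Lemma dot_gt0 (R : realType) n (x : 'cV[R]_n) : x != 0 -> 0 < dot x x.
Proof. by move=> x0; rewrite lt_def dot_eq0 x0 dot_ge0. Qed.

Lemma nrm_ge0 (R : realType) n (x : 'cV[R]_n) : 0 <= nrm x.
Proof. exact: sqrtr_ge0. Qed.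

Lemma nrm_sqr (R : realType) n (x : 'cV[R]_n) : nrm x ^+ 2 = dot x x.
Proof. by rewrite sqr_sqrtr// dot_ge0. Qed.

Lemma nrm_gt0 (R : realType) n (x : 'cV[R]_n) : x != 0 -> 0 < nrm x.
Proof. by move=> x0; rewrite sqrtr_gt0 dot_gt0. Qed.

Lemma nrm0_eq0 (R : realType) n (x : 'cV[R]_n) : (nrm x == 0) = (x == 0).
Proof. by rewrite -sqrf_eq0 nrm_sqr dot_eq0. Qed.

Lemma nrmZ (R : realType) n a (x : 'cV[R]_n) : nrm (a *: x) = `|a| * nrm x.
Proof.
by rewrite /nrm dotZl dotZr mulrA -expr2 sqrtrM ?sqr_ge0// sqrtr_sqr.
Qed.

Lemma ler_of_sqr (R : realType) (a b : R) : 0 <= b -> a ^+ 2 <= b ^+ 2 -> a <= b.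
Proof.
move=> b0 ab; case: (leP a 0) => [a0|a0]; first exact: le_trans a0 b0.
by rewrite -ler_sqr // nnegrE ltW.
Qed.

Lemma cauchy_schwarz (R : realType) n (x y : 'cV[R]_n) :
  `|dot x y| <= nrm x * nrm y.
Proof.
apply: ler_of_sqr; first by rewrite mulr_ge0// nrm_ge0.
rewrite real_normK ?num_real// exprMn !nrm_sqr.
have [->|y0] := eqVneq y 0; first by rewrite !dot0r mulr0 expr0n.
have := dot_ge0 (dot y y *: x - dot x y *: y).
rewrite !(dotBr, dotBl, dotZr, dotZl) (dotC y x).
have := dot_gt0 y0; move: (dot x x) (dot x y) (dot y y) => a b c c0 H.
have : 0 <= c * (a * c - b ^+ 2) by move: H; congr (_ <= _); ring.
by rewrite pmulr_rge0// subr_ge0.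
Qed.

Lemma nrmD (R : realType) n (x y : 'cV[R]_n) : nrm (x + y) <= nrm x + nrm y.
Proof.
apply: ler_of_sqr; first by rewrite addr_ge0// nrm_ge0.
rewrite nrm_sqr !(dotDr, dotDl) (dotC y x) sqrrD !nrm_sqr.
have := cauchy_schwarz x y; rewrite ler_norml => /andP[_ H].
by rewrite -mulr_natr; lra.
Qed.

Lemma dot_col_delta (R : realType) n (i : 'I_n) (x : 'cV[R]_n) :
  dot (delta_mx i 0) x = x i 0.
Proof.
rewrite /dot (bigD1 i)//= !mxE !eqxx mul1r big1 ?addr0// => j ji.
by rewrite mxE (negbTE ji) mul0r.
Qed.

Lemma nrm_delta (R : realType) n (i : 'I_n) : nrm (delta_mx i 0 : 'cV[R]_n) = 1.
Proof. by rewrite /nrm dot_col_delta mxE !eqxx sqrtr1. Qed.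

(** The operator norm through its bilinear form, which is the form in which it is
estimated on a net. *)
Definition opnorm_le (R : realType) n p (E : 'M[R]_(n, p)) (eps : R) : Prop :=
  forall x y, `|dot x (E *m y)| <= eps * nrm x * nrm y.

Lemma opnorm_mulmx (R : realType) n p (E : 'M[R]_(n, p)) eps y :
  0 <= eps -> opnorm_le E eps -> nrm (E *m y) <= eps * nrm y.
Proof.
move=> eps0 H; have [->|z0] := eqVneq (E *m y) 0.
  by rewrite /nrm dot0r sqrtr0 mulr_ge0// sqrtr_ge0.
have := H (E *m y) y; rewrite -nrm_sqr ger0_norm ?sqr_ge0// expr2 mulrAC.
by rewrite ler_pM2r// nrm_gt0.
Qed.

Lemma opnorm_tr (R : realType) n p (E : 'M[R]_(n, p)) eps :
  opnorm_le E eps -> opnorm_le E^T eps.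
Proof. by move=> H x y; rewrite dot_mulmx trmxK dotC (le_trans (H _ _))// mulrAC. Qed.

Lemma dot_mulmx_sum (R : realType) n p (E : 'M[R]_(n, p)) x y :
  dot x (E *m y) = \sum_k x k.1 0 * y k.2 0 * E k.1 k.2.
Proof.
rewrite -(pair_bigA _ (fun i j => x i 0 * y j 0 * E i j))/=.
apply: eq_bigr => i _; rewrite mxE mulr_sumr; apply: eq_bigr => j _.
by rewrite -mulrA [E i j * _]mulrC.
Qed.

(** * Small balls and finite unions *)

(** Anti-concentration of an affine function of one entry, the slope and the offset
being functions of the others. *)
Lemma small_ball_random (R : realType) (d : measure_display)
    (Omega : measurableType d) (P : probability Omega R) n p
    (u : 'I_n -> 'I_p -> {RV P >-> R}) i j
    (a b : mxspace R n p -> R) (eta : R) :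
  iid_std_normal u -> 0 < eta -> measurable_fun setT a -> measurable_fun setT b ->
  (P [set w | let A := mask (~: [set (i, j)]) (\matrix_(i, j) u i j w) in
      (eta < `|a A|)%R && (`|a A * u i j w + b A| <= eta ^+ 2)%R] <= eta%:E)%E.
Proof.
move=> iid eta0 ma mb; pose J : {set 'I_n * 'I_p} := [set (i, j)]%SET.
pose Q : set (mxspace R n p * mxspace R n p) := [set z |
  eta < `|a z.1|] `&` [set z |
  `|a z.1 * (z.2 : 'M[R]_(n, p)) i j + b z.1| <= eta ^+ 2].
have mfst f : measurable_fun setT f ->
    measurable_fun [set: mxspace R n p * mxspace R n p]
      (fun z : mxspace R n p * mxspace R n p => f z.1 : R).
  by move=> mf; apply: measurableT_comp => //; exact: measurable_fst.
have mQ : measurable Q.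
  apply: measurableI.
    apply: measurable_set_lt => //; apply: measurable_abs; exact: mfst.
  apply: measurable_set_le => //; apply: measurable_abs.
  apply: measurable_funD; last exact: mfst.
  apply: measurable_funM; first exact: mfst.
  by apply: (measurableT_comp (measurable_entry i j)); exact: measurable_snd.
have QE z w : Q (z, mask J (\matrix_(i, j) u i j w)) =
    ((eta < `|a z|) && (`|a z * u i j w + b z| <= eta ^+ 2)) :> Prop.
  rewrite /Q/= /setI/= /mask !mxE inE eqxx.
  by apply/propext; split=> [[-> ->]|/andP].
rewrite /= (_ : [set w | _] = [set w | Q (mask (~: J) (\matrix_(i, j) u i j w),
    mask J (\matrix_(i, j) u i j w))]); last by apply: eq_set => w; rewrite QE.
apply: independent_section_bound => // z.
under eq_set do rewrite QE.
have [az|az] := ltP eta `|a z|; last first.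
  by rewrite /= (_ : [set w | _] = set0) ?measure0 ?lee_fin ?ltW//;
     apply/seteqP; split.
apply: le_trans (normal_small_ball i j (b z / a z) iid (ltW eta0)).
have a0 : a z != 0 by rewrite -normr_gt0 (lt_trans eta0).
apply: le_measure; rewrite ?inE.
- apply: measurable_set_le => //; apply: measurable_abs.
  by apply: measurable_funD => //; exact: measurable_funM.
- by apply: measurable_set_le => //; apply: measurable_abs; exact: measurable_funD.
move=> w /= H.
have -> : u i j w + b z / a z = (a z * u i j w + b z) / a z by field.
rewrite normrM normfV ler_pdivrMr ?normr_gt0//.
by apply: le_trans H _; rewrite expr2 ler_wpM2l// ltW.
Qed.

Lemma finite_union_bound (R : realType) (d : measure_display)
    (Omega : measurableType d) (P : probability Omega R) (I : eqType)
    (s : seq I) (F : I -> set Omega) (b : R) :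
  (forall k, k \in s -> measurable (F k) /\ (P (F k) <= b%:E)%E) ->
  measurable [set w | exists2 k, k \in s & F k w] /\
  (P [set w | exists2 k, k \in s & F k w] <= ((size s)%:R * b)%:E)%E.
Proof.
elim: s => [_|k s IH H].
  rewrite (_ : [set w | _] = set0); last by apply/seteqP; split => w //= [].
  by rewrite measure0 mul0r.
rewrite (_ : [set w | _] = F k `|` [set w | exists2 k, k \in s & F k w]).
  have [mk Pk] := H k (mem_head _ _).
  have [|ms Ps] := IH; first by move=> j js; apply: H; rewrite inE js orbT.
  split; first exact: measurableU.
  apply: le_trans (measureU2 _ _ _) _ => //.
  by rewrite /= -natr1 mulrDl mul1r EFinD addeC; exact: leeD.
apply/seteqP; split => w /=.
  by move=> [j]; rewrite inE => /predU1P[->|js] Fj; [left|right; exists j].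
by move=> [Fk|[j js Fj]]; [exists k; rewrite ?mem_head|exists j; rewrite ?inE ?js ?orbT].
Qed.

(** * The operator norm of a Gaussian matrix *)

Notation lattice n := {ffun 'I_n -> bool * 'I_(5 * n).+1}.

(** An integer point is encoded by signs and absolute values; 0 has two codes, which
only costs a factor in the count. *)
Definition lattice_coord (R : realType) n (z : lattice n) (i : 'I_n) : R :=
  (-1) ^+ (z i).1 * (z i).2%:R.

(** The points reached when a vector of the unit ball, stretched by 4 sqrt n, is
rounded coordinatewise. *)
Definition lattice_net n : {set lattice n} :=
  [set z : lattice n |
    (\sum_i (z i).2 <= 5 * n)%N && (\sum_i (z i).2 ^ 2 <= 25 * n)%N]%SET.

(** Each point of the net has weight at least 1 for the weight 2^(5n - sum |z_i|),
which is a product over the coordinates with factors at most 2^5 * 4. *)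
Lemma lattice_net_card (R : realType) n :
  #|lattice_net n|%:R <= 128 ^+ n :> R.
Proof.
pose h (k : nat) : R := 2^-1 ^+ k.
have hsum m : \sum_(k < m) h k <= 2.
  suff -> : \sum_(k < m) h k = 2 - 2 * h m.
    by rewrite gerBl mulr_ge0// exprn_ge0.
  elim: m => [|m IH]; first by rewrite big_ord0 /h expr0; ring.
  by rewrite big_ord_recr/= IH /h exprS; field.
apply: (@le_trans _ _ (\sum_(z : lattice n) 2 ^+ (5 * n) * \prod_i h (z i).2)).
  rewrite -sum1_card natr_sum big_mkcond/=; apply: ler_sum => z _.
  have h0 : 0 <= 2 ^+ (5 * n) * \prod_i h (z i).2.
    by rewrite mulr_ge0 ?exprn_ge0// prodr_ge0// => i _; rewrite exprn_ge0.
  case: ifP => //; rewrite inE => /andP[z5 _].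
  rewrite /h prodrXr.
  rewrite exprVn ler_pdivlMr ?mul1r ?exprn_gt0//.
  by rewrite ler_weXn2l// ler1n.
rewrite -mulr_sumr -(bigA_distr_bigA (fun _ (k : bool * 'I_(5 * n).+1) => h k.2)).
rewrite prodr_const card_ord.
apply: (@le_trans _ _ (2 ^+ (5 * n) * 4 ^+ n)).
  rewrite ler_wpM2l ?exprn_ge0// lerXn2r ?nnegrE//.
    by apply: sumr_ge0 => k _; rewrite exprn_ge0.
  rewrite -(pair_bigA _ (fun (_ : bool) (k : 'I_(5 * n).+1) => h k))/=.
  by rewrite big_bool/=; have := hsum (5 * n).+1; lra.
rewrite exprM -exprMn lerXn2r ?nnegrE ?mulr_ge0 ?exprn_ge0//.
by rewrite (_ : 2 ^+ 5 * 4 = 128) //; ring.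
Qed.

(** Rounding up or down according to the sign of c never decreases a linear form. *)
Lemma round_coordinate (R : realType) (c x : R) :
  exists s : bool, exists k : nat,
    c * x <= c * ((-1) ^+ s * k%:R) /\ k%:R <= `|x| + 1.
Proof.
have [m_le lt_m] : (Num.truncn `|x|)%:R <= `|x| /\ `|x| < (Num.truncn `|x|).+1%:R.
  by have /andP[] := truncn_itv (normr_ge0 x).
set m := Num.truncn _ in m_le lt_m.
pose s := x < 0.
have xE : x = (-1) ^+ s * `|x|.
  rewrite /s; case: ltP => x0; first by rewrite ltr0_norm// expr1 mulN1r opprK.
  by rewrite ger0_norm// mul1r.
have [cs|cs] := leP 0 (c * (-1) ^+ s).
  exists s, m.+1; split; last by rewrite -natr1 lerD2r.
  by rewrite [in leLHS]xE !mulrA ler_wpM2l// ltW.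
exists s, m; split; last by apply: le_trans m_le _; rewrite lerDl.
by rewrite [in leLHS]xE !mulrA ler_wnM2l// ltW.
Qed.

(** Since a linear form can be rounded upwards, its supremum over the unit ball is
reached on the net, without the loss of the usual approximation argument. *)
Lemma round_vector (R : realType) n (c x : 'cV[R]_n) :
  dot x x <= 1 -> exists2 z, z \in lattice_net n &
    4 * Num.sqrt n%:R * dot c x <= \sum_i c i 0 * lattice_coord R z i.
Proof.
move=> x1; set q := 4 * Num.sqrt n%:R.
have q2 : q ^+ 2 = 16 * n%:R by rewrite exprMn sqr_sqrtr//; ring.
have q0 : 0 <= q by rewrite mulr_ge0// sqrtr_ge0.
have : forall i, exists sk : bool * nat,
    c i 0 * (q * x i 0) <= c i 0 * ((-1) ^+ sk.1 * sk.2%:R) /\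
    sk.2%:R <= `|q * x i 0| + 1.
  by move=> i; have [s [k sk]] := round_coordinate (c i 0) (q * x i 0); exists (s, k).
move=> /choice[r rP].
(* AM-GM, to avoid square roots: with q = 4 sqrt n, q |x| <= 2 n x^2 + 2. *)
have abs_sum : \sum_i `|q * x i 0| <= 4 * n%:R.
  apply: (@le_trans _ _ (\sum_i (2 * n%:R * (x i 0 * x i 0) + 2))).
    apply: ler_sum => i _; rewrite normrM (ger0_norm q0).
    have := sqr_ge0 (Num.sqrt n%:R * `|x i 0| - 1).
    rewrite sqrrB1 exprMn sqr_sqrtr// real_normK ?num_real// expr2 /q mulr2n.
    by lra.
  rewrite big_split/= -mulr_sumr sumr_const card_ord -[2 *+ n]mulr_natr.
  rewrite -/(dot x x); have := ler_wpM2l (ler0n R n) x1.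
  by lra.
have sqr_sum : \sum_i (q * x i 0) ^+ 2 <= 16 * n%:R.
  under eq_bigr do rewrite exprMn.
  rewrite -mulr_sumr q2 (_ : \sum_i _ = dot x x); last first.
    by apply: eq_bigr => i _; rewrite expr2.
  by rewrite ler_piMr// mulr_ge0.
have k1 : (\sum_i (r i).2 <= 5 * n)%N.
  rewrite -(ler_nat R) natr_sum natrM.
  apply: (@le_trans _ _ (\sum_i (`|q * x i 0| + 1))).
    by apply: ler_sum => i _; have [] := rP i.
  by rewrite big_split/= sumr_const card_ord; move: abs_sum; lra.
have k2 : (\sum_i (r i).2 ^ 2 <= 25 * n)%N.
  rewrite -(ler_nat R) natr_sum natrM.
  apply: (@le_trans _ _ (\sum_i ((q * x i 0) ^+ 2 + (2 * `|q * x i 0| + 1)))).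
    apply: ler_sum => i _; have [_ H] := rP i.
    rewrite natrX (le_trans (lerXn2r 2 _ _ H)) ?nnegrE ?addr_ge0//.
    by rewrite sqrrD1 real_normK ?num_real// mulr2n; lra.
  rewrite !big_split/= -mulr_sumr sumr_const card_ord.
  by move: abs_sum sqr_sum; lra.
have kn i : ((r i).2 < (5 * n).+1)%N.
  by rewrite ltnS (leq_trans _ k1)// (bigD1 i)//= leq_addr.
exists [ffun i => ((r i).1, inord (r i).2)].
  rewrite inE; apply/andP; split.
    by under eq_bigr do rewrite ffunE/= inordK//.
  by under eq_bigr do rewrite ffunE/= inordK//.
rewrite /dot mulr_sumr; apply: ler_sum => i _.
rewrite mulrCA /lattice_coord ffunE/= inordK//.
by have [] := rP i.
Qed.

Lemma lattice_net_sqr (R : realType) n (z : lattice n) :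
  z \in lattice_net n -> \sum_i (lattice_coord R z i) ^+ 2 <= 25 * n%:R.
Proof.
rewrite inE => /andP[_]; rewrite -(ler_nat R) natr_sum natrM.
congr (_ <= _); apply: eq_bigr => i _.
by rewrite /lattice_coord exprMn sqrr_sign mul1r natrX.
Qed.

(** The two arguments of the bilinear form are rounded one after the other; the form is
linear in each. *)
Lemma opnorm_of_net (R : realType) n p (E : 'M[R]_(n, p)) (t : R) :
  (0 < n)%N -> (0 < p)%N ->
  (forall z y, z \in lattice_net n -> y \in lattice_net p ->
    \sum_k lattice_coord R z k.1 * lattice_coord R y k.2 * E k.1 k.2 <=
      16 * Num.sqrt n%:R * Num.sqrt p%:R * t) ->
  opnorm_le E t.
Proof.
move=> n0 p0 H.
pose v m (z : lattice m) : 'cV[R]_m := \col_i lattice_coord R z i.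
have vE m (c : 'cV[R]_m) z : \sum_i c i 0 * lattice_coord R z i = dot c (v m z).
  by apply: eq_bigr => i _; rewrite mxE.
have sn0 : 0 < Num.sqrt n%:R :> R by rewrite sqrtr_gt0 ltr0n.
have sp0 : 0 < Num.sqrt p%:R :> R by rewrite sqrtr_gt0 ltr0n.
have unit_le x y : dot x x <= 1 -> dot y y <= 1 -> dot x (E *m y) <= t.
  move=> x1 y1.
  have [z zn] := round_vector (E *m y) x1; rewrite vE dotC => Hz.
  have [w wp] := round_vector (E^T *m v n z) y1; rewrite vE => Hw.
  have := H z w zn wp.
  have -> : \sum_k lattice_coord R z k.1 * lattice_coord R w k.2 * E k.1 k.2 =
      dot (E^T *m v n z) (v p w).
    by rewrite -dot_mulmx dot_mulmx_sum; apply: eq_bigr => k _; rewrite !mxE.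
  move=> Hzw; have {}Hw := le_trans Hw Hzw.
  rewrite -dot_mulmx dotC in Hw.
  have : (4 * Num.sqrt p%:R) * (4 * Num.sqrt n%:R) * dot x (E *m y) <=
      16 * Num.sqrt n%:R * Num.sqrt p%:R * t.
    apply: le_trans Hw; rewrite -mulrA ler_wpM2l// mulr_ge0// ltW//.
  rewrite (_ : 4 * _ * (4 * _) = 16 * Num.sqrt n%:R * Num.sqrt p%:R); last by ring.
  by rewrite ler_pM2l// !mulr_gt0.
have norm_le x y : dot x (E *m y) <= t * nrm x * nrm y.
  have [->|x0] := eqVneq x 0.
    by rewrite dotC dot0r /nrm dot0r sqrtr0 mulr0 mul0r.
  have [->|y0] := eqVneq y 0.
    by rewrite mulmx0 dot0r /nrm dot0r sqrtr0 mulr0.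
  have unitZ m (a : 'cV[R]_m) : a != 0 -> dot ((nrm a)^-1 *: a) ((nrm a)^-1 *: a) <= 1.
    move=> a0; rewrite dotZl dotZr -nrm_sqr mulrA -expr2 -exprMn mulVf ?expr1n//.
    by rewrite nrm0_eq0.
  have := unit_le _ _ (unitZ _ _ x0) (unitZ _ _ y0).
  rewrite -scalemxAr dotZr dotZl mulrA -invfM.
  rewrite mulrC ler_pdivrMr; last by rewrite mulr_gt0// nrm_gt0.
  by rewrite mulrA mulrAC.
move=> x y; rewrite ler_norml norm_le andbT lerNl.
have := norm_le (- x) y; rewrite -scaleN1r dotZl nrmZ mulN1r normrN normr1 mul1r.
by [].
Qed.

(** A union bound over 128^(n + p) pairs of lattice points. The variance of the form at
a pair is at most 625 n p, and 80 sqrt (n p) sqrt (n + p) is exceeded with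
probability at most exp (- 5.12 (n + p)), which beats the number of pairs as
exp 5 > 128. *)
Lemma gaussian_opnorm (R : realType) (d : measure_display)
    (Omega : measurableType d) (P : probability Omega R) n p
    (u : 'I_n -> 'I_p -> {RV P >-> R}) :
  iid_std_normal u -> (0 < n)%N -> (0 < p)%N ->
  exists B : set Omega, [/\ measurable B,
    (P B <= ((128 * expR (-5)) ^+ (n + p))%:E)%E &
    forall w, ~ B w ->
      opnorm_le (\matrix_(i, j) u i j w) (5 * Num.sqrt (n + p)%:R)].
Proof.
move=> iid n0 p0; pose t : R := 80 * Num.sqrt n%:R * Num.sqrt p%:R * Num.sqrt (n + p)%:R.
pose c (zy : lattice n * lattice p) (k : 'I_n * 'I_p) : R :=
  lattice_coord R zy.1 k.1 * lattice_coord R zy.2 k.2.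
pose F zy := [set w | t <= \sum_(k in [set: 'I_n * 'I_p]%SET) c zy k * u k.1 k.2 w].
have sumT (h : 'I_n * 'I_p -> R) :
    \sum_(k in [set: 'I_n * 'I_p]%SET) h k = \sum_k h k.
  by apply: eq_bigl => k; rewrite inE.
pose net := enum (finset.setX (lattice_net n) (lattice_net p)).
have FP zy : zy \in net -> measurable (F zy) /\
    (P (F zy) <= (expR (-5) ^+ (n + p))%:E)%E.
  rewrite mem_enum inE => /andP[zn yp].
  have mF : measurable (F zy).
    by apply: measurable_set_le => //; apply: measurable_sum_in => k; exact: measurable_funM.
  split => //.
  have v0 : 0 < (25 * n%:R) * (25 * p%:R) :> R by rewrite !mulr_gt0// ltr0n.
  apply: le_trans (gauss_tail iid v0 _ _) _.
  - rewrite sumT; have -> : \sum_k c zy k ^+ 2 =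
        (\sum_i lattice_coord R zy.1 i ^+ 2) * (\sum_j lattice_coord R zy.2 j ^+ 2).
      rewrite big_distrlr/= pair_bigA; apply: eq_bigr => k _.
      by rewrite /c exprMn.
    rewrite ler_pM ?lattice_net_sqr//.
      by apply: sumr_ge0 => i _; rewrite sqr_ge0.
    by apply: sumr_ge0 => i _; rewrite sqr_ge0.
  - by rewrite !mulr_ge0// sqrtr_ge0.
  rewrite lee_fin -expRM_natr ler_expR.
  have -> : t ^+ 2 = 6400 * n%:R * p%:R * (n + p)%:R.
    by rewrite /t !exprMn !sqr_sqrtr//; ring.
  have np : 0 < (n%:R : R) /\ 0 < (p%:R : R) by rewrite !ltr0n.
  have -> : 6400 * n%:R * p%:R * (n + p)%:R / (2 * (25 * n%:R * (25 * p%:R))) =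
      (128 / 25) * (n + p)%:R :> R.
    by field; rewrite !gt_eqF; case: np.
  by have := ler0n R (n + p); lra.
have [mB PB] := finite_union_bound FP.
exists [set w | exists2 zy, zy \in net & F zy w]; split => //.
  apply: le_trans PB _; rewrite lee_fin exprMn ler_wpM2r ?exprn_ge0 ?expR_ge0//.
  rewrite -cardE cardsX natrM exprD.
  by rewrite ler_pM// lattice_net_card.
move=> w Bw; apply: opnorm_of_net => // z y zn yp.
rewrite leNgt; apply/negP => tw; apply: Bw; exists (z, y).
  by rewrite mem_enum inE zn.
rewrite /F/= sumT; apply: ltW.
move: tw; congr (is_true (_ < _)); first by rewrite /t; ring.
by apply: eq_bigr => k _; rewrite mxE.
Qed.

(** * Rayleigh quotients and the first principal component *)

Definition frob (R : realType) n p (A : 'M[R]_(n, p)) : R :=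
  \sum_i dot (row i A)^T (row i A)^T.

Lemma mulmx_dot_row (R : realType) n p (A : 'M[R]_(n, p)) y i :
  (A *m y) i 0 = dot (row i A)^T y.
Proof. by rewrite mxE; apply: eq_bigr => j _; rewrite !mxE. Qed.

Lemma cauchy_schwarz_sqr (R : realType) n (x y : 'cV[R]_n) :
  dot x y ^+ 2 <= dot x x * dot y y.
Proof.
rewrite -real_normK ?num_real// -!nrm_sqr -exprMn.
by rewrite lerXn2r ?nnegrE ?mulr_ge0 ?nrm_ge0// cauchy_schwarz.
Qed.

Lemma frob_mulmx (R : realType) n p (A : 'M[R]_(n, p)) y :
  dot (A *m y) (A *m y) <= frob A * dot y y.
Proof.
rewrite mulr_suml; apply: ler_sum => i _.
by rewrite -expr2 mulmx_dot_row cauchy_schwarz_sqr.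
Qed.

Lemma frob_ge0 (R : realType) n p (A : 'M[R]_(n, p)) : 0 <= frob A.
Proof. by apply: sumr_ge0 => i _; exact: dot_ge0. Qed.

(** The discriminant of a nonnegative quadratic polynomial. *)
Lemma psd_cauchy_schwarz (R : realType) n (Q : 'M[R]_n) x y :
  Q^T = Q -> (forall z, 0 <= dot z (Q *m z)) ->
  dot x (Q *m y) ^+ 2 <= dot x (Q *m x) * dot y (Q *m y).
Proof.
move=> sQ Q0.
have sym : dot y (Q *m x) = dot x (Q *m y) by rewrite dot_mulmx sQ dotC.
have H t : 0 <= dot x (Q *m x) - 2 * t * dot x (Q *m y) + t ^+ 2 * dot y (Q *m y).
  have := Q0 (x - t *: y).
  rewrite mulmxBr -scalemxAr !(dotBl, dotBr, dotZl, dotZr) sym.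
  by congr (_ <= _); ring.
move: (Q0 y) H; rewrite le_eqVlt => /predU1P[<-|y0] H.
  rewrite mulr0; move: (dot x (Q *m y)) (dot x (Q *m x)) H => b a H.
  have [->|b0] := eqVneq b 0; first by rewrite expr0n.
  have := H ((a + 1) / (2 * b)); rewrite mulr0 addr0.
  rewrite (_ : 2 * _ * _ = a + 1); last by field.
  by rewrite opprD addrA subrr add0r oppr_ge0 ler10.
have := H (dot x (Q *m y) / dot y (Q *m y)).
move: (dot x (Q *m y)) (dot x (Q *m x)) (dot y (Q *m y)) y0 => b a c y0.
rewrite (_ : _ + _ = (a * c - b ^+ 2) / c); last by field; rewrite gt_eqF.
by rewrite pmulr_lge0 ?invr_gt0// subr_ge0.
Qed.

(** The supremum mu of the Rayleigh quotient is an eigenvalue. Otherwise Q = mu - S is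
invertible, and the Cauchy-Schwarz inequality for the form Q at x and Q^-1 x bounds
the form Q below by a positive multiple of the squared norm, so that mu would not be
the least upper bound. *)
Lemma rayleigh (R : realType) n (S : 'M[R]_n) (lam : R) :
  S^T = S -> (forall mu, eigenvalue S mu -> mu <= lam) ->
  forall x, dot x (S *m x) <= lam * dot x x.
Proof.
move=> sS eig x; have [->|x0] := eqVneq x 0; first by rewrite mulmx0 !dot0r mulr0.
pose A : set R := [set r | exists2 z : 'cV[R]_n, z != 0 & r = dot z (S *m z) / dot z z].
have ubA : has_ubound A.
  exists (Num.sqrt (frob S)) => _ [z z0 ->].
  rewrite ler_pdivrMr ?dot_gt0//; apply: le_trans (ler_norm _) _.
  apply: le_trans (cauchy_schwarz _ _) _.
  rewrite -nrm_sqr expr2 mulrA mulrC ler_wpM2r ?nrm_ge0//.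
  by rewrite -sqrtrM ?frob_ge0// ler_wsqrtr// frob_mulmx.
have supA : has_sup A by split => //; exists (dot x (S *m x) / dot x x), x.
pose mu := sup A.
have le_mu z : dot z (S *m z) <= mu * dot z z.
  have [->|z0] := eqVneq z 0; first by rewrite mulmx0 !dot0r mulr0.
  rewrite -ler_pdivrMr ?dot_gt0//; apply: sup_upper_bound => //.
  by exists z.
apply: le_trans (le_mu x) _; rewrite ler_wpM2r ?dot_ge0//; apply: eig.
rewrite /eigenvalue /eigenspace kermx_eq0 row_free_unit; apply/negP => unitQ.
pose Q := mu%:M - S.
have {}unitQ : Q \in unitmx.
  by rewrite /Q -opprB -scaleN1r unitmxZ ?unitrN1.
have QE z : dot z (Q *m z) = mu * dot z z - dot z (S *m z).
  by rewrite mulmxBl mul_scalar_mx dotBr dotZr.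
have Q0 z : 0 <= dot z (Q *m z) by rewrite QE subr_ge0.
have sQ : Q^T = Q by rewrite /Q linearB/= tr_scalar_mx sS.
pose C := Num.sqrt (frob (invmx Q)) + 1.
have C0 : 0 < C by rewrite ltr_wpDl// sqrtr_ge0.
have lowQ z : dot z z <= C * dot z (Q *m z).
  have [->|z0] := eqVneq z 0; first by rewrite mulmx0 !dot0r mulr0.
  have := psd_cauchy_schwarz z (invmx Q *m z) sQ Q0.
  rewrite mulKVmx// => H.
  have inv_le : dot (invmx Q *m z) z <= C * dot z z.
    apply: le_trans (ler_norm _) _; apply: le_trans (cauchy_schwarz _ _) _.
    rewrite -[dot z z]nrm_sqr expr2 mulrA ler_wpM2r ?nrm_ge0//.
    apply: (@le_trans _ _ (Num.sqrt (frob (invmx Q)) * nrm z)).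
      by rewrite -sqrtrM ?frob_ge0// ler_wsqrtr// frob_mulmx.
    by rewrite ler_wpM2r ?nrm_ge0// lerDl.
  rewrite -(ler_pM2r (dot_gt0 z0)) -expr2; apply: le_trans H _.
  rewrite [leRHS](_ : _ = dot z (Q *m z) * (C * dot z z)); last by ring.
  by rewrite ler_wpM2l ?Q0.
(* If mu%:M - S were invertible, the form would stay away from its supremum. *)
have : sup A <= mu - C^-1.
  apply: ge_sup; first by case: supA.
  move=> _ [z z0 ->]; rewrite ler_pdivrMr ?dot_gt0// mulrBl.
  rewrite lerBrDr -lerBrDl -QE.
  by rewrite mulrC ler_pdivrMr// mulrC.
by rewrite leNgt gtrBl invr_gt0 C0.
Qed.

(** What the estimated loading is used for: W *m W^T stretches it by lam, the square of
the largest singular value, and W and W^T stretch nothing more. *)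
Lemma loading_spec (R : realType) n p (W : 'M[R]_(n, p)) (L : 'cV[R]_n) :
  pca_loading W L -> exists lam : R,
  [/\ 0 <= lam, W *m (W^T *m L) = lam *: L,
    forall x, dot (W^T *m x) (W^T *m x) <= lam * dot x x &
    forall y, dot (W *m y) (W *m y) <= lam * dot y y].
Proof.
move=> [L0 [lam WL eig]]; exists lam.
have bnd x : dot (W^T *m x) (W^T *m x) <= lam * dot x x.
  rewrite dot_mulmx trmxK dotC mulmxA.
  by apply: rayleigh => //; rewrite trmx_mul trmxK.
have lam0 : 0 <= lam.
  have := le_trans (dot_ge0 _) (bnd L); rewrite pmulr_lge0//.
  exact: dot_gt0.
split => //; first by rewrite mulmxA.
move=> y; have [y0|y0] := eqVneq (W *m y) 0.
  by rewrite y0 dot0r mulr_ge0// dot_ge0.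
rewrite -(ler_pM2r (dot_gt0 y0)) -expr2 {1}dot_mulmx dotC.
apply: le_trans (cauchy_schwarz_sqr _ _) _.
by rewrite mulrC mulrAC ler_wpM2r ?dot_ge0.
Qed.

(** * Leaving one row out *)

(** Zeroing the row, rather than deleting it, keeps the dimensions, so that the same
estimator applies to the matrix without the row. *)
Definition zero_row (R : realType) n p (i0 : 'I_n) (A : 'M[R]_(n, p)) :
    'M[R]_(n, p) :=
  \matrix_(i, j) if i == i0 then 0 else A i j.

Lemma zero_row_mulE (R : realType) n p (i0 : 'I_n) (A : 'M[R]_(n, p))
    (y : 'cV[R]_p) i :
  (zero_row i0 A *m y) i 0 = if i == i0 then 0 else (A *m y) i 0.
Proof.
rewrite !mxE; case: eqP => [->|ii0].
  by rewrite big1// => j _; rewrite mxE eqxx mul0r.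
by apply: eq_bigr => j _; rewrite mxE; case: eqP ii0.
Qed.

Lemma dot_zero_row (R : realType) n p (i0 : 'I_n) (W : 'M[R]_(n, p))
    (y z : 'cV[R]_p) :
  dot (W *m y) (W *m z) = dot (row i0 W)^T y * dot (row i0 W)^T z +
    dot (zero_row i0 W *m y) (zero_row i0 W *m z).
Proof.
rewrite -!mulmx_dot_row /dot (bigD1 i0)//=; congr (_ + _).
rewrite [RHS](bigD1 i0)//= !zero_row_mulE eqxx mul0r add0r.
by apply: eq_bigr => i ii0; rewrite !zero_row_mulE (negbTE ii0).
Qed.

Lemma dot_split (R : realType) n (i0 : 'I_n) (x y : 'cV[R]_n) :
  dot x y = x i0 0 * y i0 0 + dot (row' i0 x) (row' i0 y).
Proof.
rewrite /dot (bigD1_ord i0)//=; congr (_ + _).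
by apply: eq_bigr => i _; rewrite !mxE.
Qed.

Lemma nrm_row' (R : realType) n (i0 : 'I_n) (x : 'cV[R]_n) :
  nrm (row' i0 x) <= nrm x.
Proof.
by rewrite ler_wsqrtr// (dot_split i0 x) lerDr -expr2 sqr_ge0.
Qed.

Lemma opnorm_zero_row (R : realType) n p (i0 : 'I_n) (E : 'M[R]_(n, p)) eps :
  0 <= eps -> opnorm_le E eps -> forall y, nrm (zero_row i0 E *m y) <= eps * nrm y.
Proof.
move=> eps0 H y; apply: le_trans (opnorm_mulmx y eps0 H).
rewrite ler_wsqrtr// (dot_zero_row i0 E) lerDr -expr2 sqr_ge0//.
Qed.

Lemma dot_scale_mulmx (R : realType) n p (B : 'M[R]_(n, p)) (r z : 'cV[R]_p) lam :
  B^T *m (B *m r) = lam *: r -> dot (B *m r) (B *m z) = lam * dot r z.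
Proof. by move=> H; rewrite dot_mulmx H dotZl. Qed.

(** Weyl's inequality for a perturbation of rank one: orthogonally to the first right
singular vector r0, B is no larger than the noise. On the plane spanned by r0 and a
vector y orthogonal to it some combination is orthogonal to F, and B acts on it as
E does. *)
Lemma rank_one_second_singular (R : realType) n p (B E : 'M[R]_(n, p))
    (a : 'cV[R]_n) (F : 'cV[R]_p) (r0 y : 'cV[R]_p) lam0 eps :
  B = a *m F^T + E -> (forall z, nrm (E *m z) <= eps * nrm z) ->
  B^T *m (B *m r0) = lam0 *: r0 -> (r0 = 0 -> lam0 = 0) ->
  (forall z, dot (B *m z) (B *m z) <= lam0 * dot z z) ->
  dot r0 y = 0 -> dot (B *m y) (B *m y) <= eps ^+ 2 * dot y y.
Proof.
move=> BE Eeps Br0 r0lam Blam ry.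
have orthF z : dot F z = 0 -> dot (B *m z) (B *m z) <= eps ^+ 2 * dot z z.
  move=> Fz; have -> : B *m z = E *m z.
    rewrite BE mulmxDl -mulmxA (_ : F^T *m z = 0) ?mulmx0 ?add0r//.
    by apply/colP => i; rewrite ord1 dotE Fz mxE.
  rewrite -!nrm_sqr -exprMn lerXn2r ?nnegrE ?nrm_ge0// (le_trans (nrm_ge0 (E *m z)))//.
rewrite leNgt; apply/negP => lt_y.
have y0 : y != 0.
  by apply: contraTneq lt_y => ->; rewrite mulmx0 !dot0r mulr0 ltxx.
(* If B stretches y by more than eps, then r0 as well, hence every nonzero
   combination of these orthogonal vectors, whose images are orthogonal too. But
   some combination is orthogonal to F. *)
have lt_lam : eps ^+ 2 < lam0.
  by have := lt_le_trans lt_y (Blam y); rewrite ltr_pM2r// dot_gt0.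
have r0n : r0 != 0.
  apply: contraTneq lt_lam => /r0lam ->; rewrite -leNgt; exact: sqr_ge0.
pose f := dot F y; pose g := dot F r0.
have /orthF : dot F (f *: r0 - g *: y) = 0 by rewrite dotBr !dotZr mulrC subrr.
rewrite mulmxBr -!scalemxAr !(dotBl, dotBr, dotZl, dotZr).
rewrite [dot (B *m y) (B *m r0)]dotC !(dot_scale_mulmx _ Br0) [dot y r0]dotC ry !mulr0 !subr0 !sub0r !opprK.
rewrite leNgt => /negP; apply.
have [g0|gn] := eqVneq g 0.
  have fn : f != 0.
    apply: contraTneq lt_y => f0; rewrite -leNgt; exact: orthF.
  rewrite g0 !mul0r !addr0 !mulrA -subr_gt0.
  rewrite (_ : _ - _ = f ^+ 2 * (lam0 - eps ^+ 2) * dot r0 r0); last by ring.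
  apply: mulr_gt0 (dot_gt0 r0n); apply: mulr_gt0; last by rewrite subr_gt0.
  by rewrite exprn_even_gt0.
rewrite -subr_gt0.
rewrite (_ : _ - _ = f ^+ 2 * ((lam0 - eps ^+ 2) * dot r0 r0) +
   g ^+ 2 * (dot (B *m y) (B *m y) - eps ^+ 2 * dot y y)); last by ring.
apply: ltr_wpDl.
  by apply: mulr_ge0 (sqr_ge0 _) _; rewrite mulr_ge0 ?dot_ge0// subr_ge0 ltW.
by apply: mulr_gt0; rewrite ?subr_gt0// exprn_even_gt0.
Qed.

(** The right singular vector r of W and the one r0 of W without the row i0 differ little,
and r0 does not depend on that row. Writing r = rho *: r0 + y with y orthogonal to r0,
the eigenvector equation bounds y through the row, and the noise e of the row is small
along r0 by independence. Bounding e along r through the operator norm alone would lose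
a factor of the order of the square root of n. *)
Lemma leave_one_out (R : realType) n p (i0 : 'I_n) (W : 'M[R]_(n, p))
    (e r r0 : 'cV[R]_p) lam lam0 eps K :
  W^T *m (W *m r) = lam *: r ->
  (zero_row i0 W)^T *m (zero_row i0 W *m r0) = lam0 *: r0 ->
  (forall y, dot r0 y = 0 ->
    dot (zero_row i0 W *m y) (zero_row i0 W *m y) <= eps ^+ 2 * dot y y) ->
  eps ^+ 2 < lam -> 0 <= K -> `|dot e r0| <= K * nrm r0 ->
  (lam - eps ^+ 2) * `|dot e r| <= (lam - eps ^+ 2) * K * nrm r +
    nrm e * nrm (row i0 W)^T * `|dot (row i0 W)^T r|.
Proof.
move=> Wr Br0 Beps lam_eps K0 er0.
set w := (row i0 W)^T; set B := zero_row i0 W in Br0 Beps *.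
have [rho [y [rE ry]]] : exists rho y, r = rho *: r0 + y /\ dot r0 y = 0.
  pose rho := dot r0 r / dot r0 r0; exists rho, (r - rho *: r0).
  split; first by rewrite addrC subrK.
  rewrite dotBr dotZr /rho; have [->|r0n] := eqVneq r0 0.
    by rewrite dotC !dot0r mulr0 subrr.
  by rewrite divfK ?subrr// dot_eq0.
have drho : dot r r = rho ^+ 2 * dot r0 r0 + dot y y.
  by rewrite rE !(dotDl, dotDr, dotZl, dotZr) (dotC y r0) ry; ring.
have rho_le : `|rho| * nrm r0 <= nrm r.
  apply: ler_of_sqr; first exact: nrm_ge0.
  by rewrite exprMn real_normK ?num_real// !nrm_sqr drho lerDl dot_ge0.
have y_le : (lam - eps ^+ 2) * nrm y <= nrm w * `|dot w r|.
  have [->|y0] := eqVneq y 0; first by rewrite /nrm dot0r sqrtr0 mulr0 mulr_ge0// sqrtr_ge0.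
  rewrite -(ler_pM2r (nrm_gt0 y0)) -mulrA -expr2 nrm_sqr.
  have : lam * dot y y = dot w r * dot w y + dot (B *m y) (B *m y).
    have := dot_scale_mulmx y Wr; rewrite (dot_zero_row i0) -/w -/B => H.
    have -> : dot y y = dot r y by rewrite [in RHS]rE dotDl dotZl ry mulr0 add0r.
    rewrite -H; congr (_ + _).
    by rewrite [in LHS]rE mulmxDr dotDl -scalemxAr dotZl (dot_scale_mulmx _ Br0) ry !mulr0 add0r.
  have := Beps y ry; rewrite mulrBl => H ->.
  apply: (@le_trans _ _ (dot w r * dot w y)); first by rewrite lerBlDr lerD2l.
  apply: le_trans (ler_norm _) _; rewrite normrM mulrC mulrAC.
  by rewrite ler_wpM2r// cauchy_schwarz.
have er : `|dot e r| <= K * nrm r + nrm e * nrm y.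
  rewrite [in leLHS]rE dotDr dotZr; apply: le_trans (ler_normD _ _) _; apply: lerD.
    rewrite normrM; apply: le_trans (ler_wpM2l (normr_ge0 _) er0) _.
    by rewrite mulrCA ler_wpM2l.
  exact: cauchy_schwarz.
apply: le_trans (ler_wpM2l _ er) _; first by rewrite subr_ge0 ltW.
rewrite mulrDr -mulrA lerD2l mulrCA -mulrA ler_wpM2l ?nrm_ge0//.
Qed.

(** * A deterministic error bound *)

Lemma zero_row_rank_one (R : realType) n p (i0 : 'I_n) (a : 'cV[R]_n)
    (F : 'cV[R]_p) (E : 'M[R]_(n, p)) :
  zero_row i0 (a *m F^T + E) = zero_row i0 a *m F^T + zero_row i0 E.
Proof.
apply/matrixP => i j; rewrite !mxE !big_ord1 !mxE.
by case: eqP => // _; rewrite mul0r addr0.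
Qed.

Lemma nrm_row (R : realType) n p (i0 : 'I_n) (E : 'M[R]_(n, p)) eps :
  0 <= eps -> opnorm_le E eps -> nrm (row i0 E)^T <= eps.
Proof.
move=> eps0 /opnorm_tr H.
have := opnorm_mulmx (delta_mx i0 0) eps0 H; rewrite nrm_delta mulr1.
by rewrite rowE trmx_mul trmx_delta.
Qed.

(** Arithmetic that solves the leave-one-out inequality for D, by absorbing d * D in
c * D. *)
Lemma residual_row_bound (R : realType) (c d s eps A K rho D : R) :
  0 < s -> 0 <= K -> 0 <= A -> 0 <= rho -> 0 <= eps -> 0 <= d -> 0 <= D ->
  s ^+ 2 / 4 <= c -> d <= 51 / 80 * (s ^+ 2 / 4) -> d <= eps * s / 2 ->
  c * D <= c * K * rho + d * (A * s * rho + D) ->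
  D <= (3 * K + 6 * eps * A) * rho.
Proof.
move=> s0 K0 A0 rho0 eps0 d0 D0 sc ds deps H.
have s20 : 0 < s ^+ 2 by rewrite exprn_gt0.
have c0 : 0 < c by lra.
have dD : d * D <= 51 / 80 * c * D by rewrite ler_wpM2r//; lra.
have dA : d * (A * s * rho) <= 2 * eps * c * A * rho.
  apply: (@le_trans _ _ (eps * s / 2 * (A * s * rho))).
    by rewrite ler_wpM2r// !mulr_ge0// ltW.
  rewrite [leLHS](_ : _ = (2 * eps * A * rho) * (s ^+ 2 / 4)); last by field.
  rewrite [leRHS](_ : _ = (2 * eps * A * rho) * c); last by ring.
  by rewrite ler_wpM2l// !mulr_ge0.
have : 29 / 80 * c * D <= c * (K + 2 * eps * A) * rho by lra.
rewrite (_ : _ * c * D = c * (29 / 80 * D)); last by ring.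
rewrite -(mulrA c) ler_pM2l// => {}H.
have : 0 <= K * rho by rewrite mulr_ge0.
have : 0 <= eps * A * rho by rewrite !mulr_ge0.
by lra.
Qed.

(** The deterministic part of the proof. With r = W^T *m l and lam *: l = W *m r, the signal
part of the error is g times the product of l' with l i0 *: a' - a i0 *: l', where primes
mean that the entry i0 is dropped. Multiplied by lam the last vector is
dot e r *: a' - a i0 *: z, with e the noise in the row i0 and z the noise in the other
rows along r: the rank-one part has cancelled. The size of dot e r comes from
the leave-one-out comparison. The noise part is l i0 times the noise of the column along
l'. *)
Lemma entry_error (R : realType) n p (i0 : 'I_n) (a v l l0 : 'cV[R]_n)
    (F : 'cV[R]_p) (E : 'M[R]_(n, p)) (g s eps K b kappa : R) :
  let W := a *m F^T + E in
  let r0 := (zero_row i0 W)^T *m l0 in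
  nrm a = 1 -> nrm F = s -> 0 < s -> 0 <= eps -> opnorm_le E eps ->
  eps <= 3 / 8 * s ->
  pca_loading W l -> pca_loading (zero_row i0 W) l0 -> 0 <= K ->
  `|dot (row i0 E)^T r0| <= K * nrm r0 ->
  `|dot (row' i0 l) (row' i0 v)| <= K * nrm (row' i0 l) ->
  `|a i0 0| * s <= b -> b <= s / 20 -> `|g| <= b -> `|g| * `|a i0 0| <= kappa ->
  `|l i0 0 * dot (row' i0 l) (row' i0 (g *: a + v)) /
      dot (row' i0 l) (row' i0 l) - a i0 0 * g| <=
  16 / 5 * (4 * K * b + 7 * kappa * eps + K * eps) / s.
Proof.
move=> W r0 a1 Fs s0 eps0 Eeps epss Wl Bl0 K0 er0 lv asb bs gb gak.
have l_neq0 : l != 0 by case: Wl.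
have l0_neq0 : l0 != 0 by case: Bl0.
have [lam [lam0 Wr lamW _]] := loading_spec Wl.
have [mu [mu0 Br0 _ muB]] := loading_spec Bl0.
rewrite -/r0 in Br0.
set r := W^T *m l in Wr.
set e := (row i0 E)^T in er0; set w := (row i0 W)^T.
set A := `|a i0 0| in asb gak.
have A0 : 0 <= A by exact: normr_ge0.
have b0 : 0 <= b by apply: le_trans asb; rewrite mulr_ge0// ltW.
have nl0 : 0 < nrm l by exact: nrm_gt0.
(* On the vector a the transpose of W acts as F up to noise, which bounds the
   largest singular value of W from below. *)
set om := Num.sqrt lam.
have om2 : om ^+ 2 = lam by rewrite sqr_sqrtr.
have om_ge : 5 / 8 * s <= om.
  apply: (@le_trans _ _ (s - eps)); first by lra.
  apply: (@le_trans _ _ (nrm (W^T *m a))); last first.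
    rewrite -[om]mulr1 -a1 /nrm -sqrtrM// ler_wsqrtr//; exact: lamW.
  rewrite lerBlDr -Fs.
  have -> : F = W^T *m a + (- (E^T *m a)).
    rewrite /W linearD/= trmx_mul trmxK mulmxDl addrK -mulmxA.
    rewrite [a^T *m a]mx11_scalar dotE -nrm_sqr a1 expr1n.
    by rewrite mulmx1.
  apply: le_trans (nrmD _ _) _; rewrite lerD2l -scaleN1r nrmZ normrN1 mul1r.
  by have := opnorm_mulmx a eps0 (opnorm_tr Eeps); rewrite a1 mulr1.
have om_gt0 : 0 < om by apply: lt_le_trans om_ge; rewrite mulr_gt0.
have lam_gt0 : 0 < lam by rewrite -om2 exprn_gt0.
have rho_om : nrm r = om * nrm l.
  rewrite /nrm -sqrtrM//; congr Num.sqrt.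
  by rewrite /r -dot_mulmx Wr dotZr.
(* D occurs on both sides of the leave-one-out inequality; its coefficient on
   the right is the smaller one because eps and b are small compared with s. *)
have e_le : nrm e <= eps by exact: nrm_row.
have wE : w = a i0 0 *: F + e.
  by apply/colP => j; rewrite !mxE big_ord1 !mxE.
have w_le : nrm w <= A * s + eps.
  by rewrite wE (le_trans (nrmD _ _))// nrmZ Fs lerD2l.
set D := `|dot e r|.
have wr_le : `|dot w r| <= A * s * nrm r + D.
  rewrite wE dotDl dotZl; apply: le_trans (ler_normD _ _) _; rewrite lerD2r.
  rewrite normrM -mulrA ler_wpM2l//.
  by have := cauchy_schwarz F r; rewrite Fs.
have s2 : eps ^+ 2 <= 9 / 64 * s ^+ 2.
  rewrite (_ : 9 / 64 * s ^+ 2 = (3 / 8 * s) ^+ 2); last by field.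
  by rewrite lerXn2r ?nnegrE ?mulr_ge0 ?(ltW s0).
have lam_ge : 25 / 64 * s ^+ 2 <= lam.
  rewrite (_ : 25 / 64 * s ^+ 2 = (5 / 8 * s) ^+ 2) -?om2; last by field.
  by rewrite lerXn2r ?nnegrE ?mulr_ge0 ?(ltW s0) ?(ltW om_gt0).
have s20 : 0 < s ^+ 2 by rewrite exprn_gt0.
have D_le : D <= (3 * K + 6 * eps * A) * nrm r.
  apply: (@residual_row_bound _ (lam - eps ^+ 2) (eps * (b + eps)) s) => //.
  - exact: nrm_ge0.
  - by rewrite mulr_ge0// addr_ge0.
  - exact: normr_ge0.
  - by lra.
  - apply: (@le_trans _ _ (3 / 8 * s * (17 / 40 * s))).
      by apply: ler_pM => //; [rewrite addr_ge0|lra].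
    by rewrite (_ : 51 / 80 * _ = 3 / 8 * s * (17 / 40 * s))//; field.
  - by rewrite -mulrA ler_wpM2l//; lra.
  have := @leave_one_out _ _ _ i0 W e r r0 lam mu eps K.
  rewrite -/w -/D => H.
  have {}H := H _ _ _ _ K0 er0; apply: le_trans (H _ _ _ _) _.
  - by rewrite Wr -scalemxAr.
  - by rewrite /r0 Br0 -scalemxAr.
  - move=> y; apply: (@rank_one_second_singular _ _ _ _ (zero_row i0 E)
        (zero_row i0 a) F r0 _ mu).
    + exact: zero_row_rank_one.
    + by move=> z; apply: opnorm_zero_row.
    + by rewrite Br0 -scalemxAr.
    + move=> r00; have : dot r0 r0 = mu * dot l0 l0.
        by rewrite {1}/r0 -dot_mulmx Br0 dotZr.
      rewrite r00 dot0r => /esym/eqP.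
      by rewrite mulf_eq0 dot_eq0 (negbTE l0_neq0) orbF => /eqP.
    + exact: muB.
  - by lra.
  rewrite lerD2l; apply: ler_pM => //.
  - by rewrite mulr_ge0// nrm_ge0.
  - apply: ler_pM; rewrite ?nrm_ge0//.
    by apply: le_trans w_le _; rewrite lerD2r.
(* The entry i0 carries at most (17/25)^2 of the squared norm of l: 17/25 is the
   quotient of (3/8 + 1/20) s, a bound on the norm of the row i0 of W, by 5/8 s.
   Hence the division by the squared norm of l' costs only a constant. *)
have l1E : lam * l i0 0 = dot w r.
  by rewrite -mulmx_dot_row Wr mxE.
have l1_le : `|l i0 0| * om <= (b + eps) * nrm l.
  rewrite -(ler_pM2r om_gt0) -mulrA -expr2 om2 mulrC -{1}(ger0_norm lam0) -normrM l1E.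
  apply: le_trans (cauchy_schwarz _ _) _; rewrite rho_om mulrCA mulrC.
  rewrite ler_wpM2r ?(ltW om_gt0)// ler_wpM2r ?nrm_ge0//.
  by apply: le_trans w_le _; rewrite lerD2r.
set l' := row' i0 l; set m := nrm l'.
have m_ge : nrm l / 2 <= m.
  apply: ler_of_sqr; first exact: nrm_ge0.
  rewrite /m nrm_sqr.
  have := dot_split i0 l l; rewrite -nrm_sqr -/l' -expr2.
  have : l i0 0 ^+ 2 * om ^+ 2 <= 289 / 1600 * s ^+ 2 * nrm l ^+ 2.
    rewrite -exprMn -real_normK ?num_real// normrM (ger0_norm (ltW om_gt0)).
    rewrite (_ : _ * s ^+ 2 * _ = (17 / 40 * s * nrm l) ^+ 2); last by field.
    rewrite lerXn2r ?nnegrE ?mulr_ge0 ?nrm_ge0 ?(ltW s0) ?(ltW om_gt0)//.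
    apply: le_trans l1_le _; rewrite ler_wpM2r ?nrm_ge0//; lra.
  rewrite om2 => H1 H2.
  have : l i0 0 ^+ 2 * (25 / 64 * s ^+ 2) <= 289 / 1600 * s ^+ 2 * nrm l ^+ 2.
    by apply: le_trans H1; rewrite ler_wpM2l ?sqr_ge0.
  rewrite [leLHS](_ : _ = s ^+ 2 * (25 / 64 * l i0 0 ^+ 2)); last by ring.
  rewrite [leRHS](_ : _ = s ^+ 2 * (289 / 1600 * nrm l ^+ 2)); last by ring.
  rewrite ler_pM2l// => H3.
  rewrite (_ : (nrm l / 2) ^+ 2 = nrm l ^+ 2 / 4); last by field.
  have : 0 <= nrm l ^+ 2 by exact: sqr_ge0.
  by lra.
have m0 : 0 < m by apply: lt_le_trans m_ge; rewrite divr_gt0.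
have ratio : nrm l / m / om <= 16 / 5 / s.
  rewrite ler_pdivrMr// ler_pdivrMr//.
  have : 5 / 8 * s * (nrm l / 2) <= om * m.
    by apply: ler_pM => //; rewrite ?mulr_ge0 ?divr_ge0 ?nrm_ge0 ?ltW.
  rewrite -(ler_pM2l (_ : 0 < 16 / 5 / s)); last by rewrite !divr_gt0.
  rewrite (_ : 16 / 5 / s * (5 / 8 * s * _) = nrm l); last by field; rewrite gt_eqF.
  by rewrite mulrA.
(* In l i0 *: a' - a i0 *: l' the contribution of dot F r cancels; what is left
   is first order in the noise. *)
set a' := row' i0 a; set v' := row' i0 v; set z := row' i0 (E *m r).
have xE : row' i0 (g *: a + v) = g *: a' + v' by apply/colP => i; rewrite !mxE.
have l1E' : lam * l i0 0 = dot F r * a i0 0 + dot e r.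
  by rewrite l1E wE dotDl dotZl mulrC.
have WrE : lam *: l = dot F r *: a + E *m r.
  by rewrite -Wr /W mulmxDl -mulmxA [F^T *m r]mx11_scalar dotE mul_mx_scalar.
have l'E : lam *: l' = dot F r *: a' + z.
  apply/colP => i; have := congr1 (fun M : 'cV[R]_n => M (lift i0 i) 0) WrE.
  by rewrite !mxE.
pose x := l i0 0 *: a' - a i0 0 *: l'.
have lamx : lam *: x = dot e r *: a' - a i0 0 *: z.
  rewrite /x scalerBr !scalerA l1E' (mulrC lam) -scalerA l'E scalerDl scalerDr.
  by rewrite !scalerA (mulrC (a i0 0)) opprD addrACA subrr add0r.
have x_le : `|g| * (lam * nrm x) <= (3 * K * b + 7 * kappa * eps) * nrm r.
  rewrite -{1}(ger0_norm lam0) -nrmZ lamx.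
  apply: (@le_trans _ _ (`|g| * (D + A * (eps * nrm r)))).
    rewrite ler_wpM2l//; apply: le_trans (nrmD _ _) _; apply: lerD.
      by rewrite nrmZ ler_piMr// -a1 nrm_row'.
    rewrite -scaleN1r !nrmZ normrN1 mul1r ler_wpM2l//.
    by apply: le_trans (nrm_row' _ _) _; exact: opnorm_mulmx.
  rewrite mulrDr.
  have : `|g| * D <= (3 * K * b + 6 * kappa * eps) * nrm r.
    apply: le_trans (ler_wpM2l (normr_ge0 g) D_le) _.
    rewrite mulrA ler_wpM2r ?nrm_ge0// mulrDr; apply: lerD.
      by rewrite mulrC ler_wpM2l// mulr_ge0.
    rewrite (_ : `|g| * _ = (`|g| * A) * (6 * eps)); last by ring.
    rewrite (_ : 6 * kappa * eps = kappa * (6 * eps)); last by ring.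
    by rewrite ler_wpM2r// mulr_ge0.
  have : `|g| * (A * (eps * nrm r)) <= kappa * eps * nrm r.
    by rewrite !mulrA ler_wpM2r ?nrm_ge0// ler_wpM2r.
  by lra.
have m2 : dot l' l' = m ^+ 2 by rewrite /m nrm_sqr.
rewrite -/l' xE dotDr dotZr m2.
rewrite (_ : _ - _ = g * dot l' x / m ^+ 2 + l i0 0 * dot l' v' / m ^+ 2); last first.
  by rewrite /x dotBr !dotZr m2; field; rewrite gt_eqF.
have part1 : `|g * dot l' x / m ^+ 2| <=
    (3 * K * b + 7 * kappa * eps) * (nrm l / m / om).
  rewrite !normrM normfV (ger0_norm (sqr_ge0 m)) ler_pdivrMr ?exprn_gt0//.
  rewrite (_ : _ * (nrm l / m / om) * m ^+ 2 =
     m * ((3 * K * b + 7 * kappa * eps) * nrm r / lam)); last first.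
    by rewrite rho_om -om2; field; rewrite !gt_eqF.
  apply: (@le_trans _ _ (`|g| * (m * nrm x))).
    by rewrite ler_wpM2l// cauchy_schwarz.
  rewrite mulrCA ler_wpM2l ?(ltW m0)// ler_pdivlMr//.
  by rewrite [leLHS](_ : _ = `|g| * (lam * nrm x)); last by ring.
have part2 : `|l i0 0 * dot l' v' / m ^+ 2| <=
    K * (b + eps) * (nrm l / m / om).
  rewrite !normrM normfV (ger0_norm (sqr_ge0 m)) ler_pdivrMr ?exprn_gt0//.
  rewrite (_ : _ * (nrm l / m / om) * m ^+ 2 =
     ((b + eps) * nrm l / om) * (K * m)); last by field; rewrite !gt_eqF.
  by apply: ler_pM => //; rewrite ler_pdivlMr.
apply: le_trans (ler_normD _ _) _; apply: le_trans (lerD part1 part2) _.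
rewrite -mulrDl (_ : 16 / 5 * _ / s =
  (4 * K * b + 7 * kappa * eps + K * eps) * (16 / 5 / s)); last by ring.
have kappa0 : 0 <= kappa by apply: le_trans gak; rewrite mulr_ge0.
rewrite (_ : 3 * K * b + _ + _ = 4 * K * b + 7 * kappa * eps + K * eps); last by ring.
by rewrite ler_wpM2l// !addr_ge0// !mulr_ge0.
Qed.

(** * Matrices with one nonzero singular value *)

Lemma frob_eq0 (R : realType) n p (A : 'M[R]_(n, p)) : frob A = 0 -> A = 0.
Proof.
move=> A0; apply/matrixP => i j; rewrite mxE.
move/eqP: A0; rewrite psumr_eq0 => [/allP/(_ i)|k _]; last exact: dot_ge0.
rewrite mem_index_enum dot_eq0 => /(_ isT)/eqP/colP/(_ j).
by rewrite !mxE.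
Qed.

Lemma frob_trace (R : realType) n p (A : 'M[R]_(n, p)) : frob A = \tr (A *m A^T).
Proof.
apply: eq_bigr => i _; rewrite mxE; apply: eq_bigr => j _.
by rewrite !mxE.
Qed.

Lemma frob_sub_rank_one (R : realType) n p (M : 'M[R]_(n, p)) (a : 'cV[R]_n) :
  dot a a = 1 ->
  frob (M - a *m (M^T *m a)^T) = frob M - dot (M^T *m a) (M^T *m a).
Proof.
move=> a1; set G := M^T *m a.
have rowE' i : (row i (M - a *m G^T))^T = (row i M)^T - a i 0 *: G.
  by apply/colP => j; rewrite !mxE big_ord1 !mxE.
have HG : \sum_i a i 0 * dot (row i M)^T G = dot G G.
  by rewrite {2}/G -dot_mulmx; apply: eq_bigr => i _; rewrite mulmx_dot_row.
have Ha : \sum_i a i 0 * (a i 0 * dot G G) = dot G G.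
  rewrite -[RHS]mul1r -a1 mulr_suml; apply: eq_bigr => i _; exact: mulrA.
rewrite /frob (eq_bigr (fun i => dot (row i M)^T (row i M)^T +
  (- 2 * (a i 0 * dot (row i M)^T G) + a i 0 * (a i 0 * dot G G)))).
  by rewrite !big_split/= -mulr_sumr HG Ha; ring.
by move=> i _; rewrite rowE' !(dotBl, dotBr, dotZl, dotZr) (dotC G); ring.
Qed.

(** When only one singular value s0 is nonzero, trace (M *m M^T) = s0^2. For a unit
eigenvector a, the residual M - a *m (M^T *m a)^T has squared Frobenius norm
trace (M *m M^T) - s0^2 = 0. *)
Lemma Mclass_tau_rank_one (R : realType) n p (kappa tau : R) (M : 'M[R]_(n, p)) :
  0 < tau -> Mclass_tau kappa tau M ->
  exists a : 'cV[R]_n, exists G : 'cV[R]_p,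
    [/\ M = a *m G^T, nrm a = 1 & tau <= nrm G].
Proof.
move=> tau0 [_ [s [s_sorted s_ge0 charE] [tau_s s1]]].
case: s => [|s0 s] in s_sorted s_ge0 charE tau_s s1 *.
  by rewrite /= leNgt tau0 in tau_s.
have {s1} s_eq0 : all (fun x => x == 0) s.
  case: s s1 s_sorted s_ge0 {tau_s charE} => //= x s -> /andP[_ s_path] /and3P[_ _ s_ge0].
  rewrite eqxx/=; apply/allP => y ys.
  have : all (>=%R 0) s.
    by apply: order_path_min s_path => z y' x'; exact: (rev_trans le_trans).
  move=> /allP/(_ y ys) /= y_le0; apply/eqP/le_anti; rewrite y_le0.
  by move/allP: s_ge0 => /(_ y ys).
rewrite /= in tau_s; have s00 : 0 < s0 by exact: lt_le_trans tau_s.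
set S := M *m M^T in charE.
have sS : S^T = S by rewrite trmx_mul trmxK.
rewrite -(big_map (fun x : R => x ^+ 2) xpredT (fun y => 'X - y%:P)) in charE.
have sum_s : \sum_(x <- map (fun x : R => x ^+ 2) (s0 :: s)) x = s0 ^+ 2.
  rewrite big_cons big_map big_seq big1 ?addr0// => x xs.
  by move/allP: s_eq0 => /(_ x xs)/eqP->; rewrite expr0n.
(* Only one eigenvalue is nonzero, so it is the trace. *)
have trS : \tr S = s0 ^+ 2.
  have := size_char_poly S; rewrite charE size_prod_XsubC => -[sz].
  apply: oppr_inj; rewrite -char_poly_trace -?sz ?size_map// charE -sum_s.
  by rewrite -coefPn_prod_XsubC -?sz.
have : eigenvalue S (s0 ^+ 2).
  by rewrite eigenvalue_root_char charE root_prod_XsubC inE eqxx.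
move=> /eigenvalueP[v vS v0].
pose a := (nrm v^T)^-1 *: v^T.
have nv0 : nrm v^T != 0.
  by rewrite nrm0_eq0; apply: contraNneq v0 => vT; rewrite -[v]trmxK vT trmx0.
have a1 : dot a a = 1.
  by rewrite /a dotZl dotZr -nrm_sqr mulrA -expr2 -exprMn mulVf ?expr1n.
have Sa : S *m a = s0 ^+ 2 *: a.
  rewrite /a -scalemxAr scalerA mulrC -scalerA; congr (_ *: _).
  by rewrite -[S]sS -trmx_mul vS linearZ.
have GG : dot (M^T *m a) (M^T *m a) = s0 ^+ 2.
  by rewrite dot_mulmx trmxK dotC mulmxA Sa dotZr a1 mulr1.
exists a, (M^T *m a); split.
- apply/eqP; rewrite -subr_eq0; apply/eqP/frob_eq0.
  by rewrite frob_sub_rank_one// GG frob_trace trS subrr.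
- by rewrite /nrm a1 sqrtr1.
- by rewrite /nrm GG sqrtr_sqr gtr0_norm.
Qed.

Lemma Mclass_entry (R : realType) n p (kappa : R) (M : 'M[R]_(n, p)) i j :
  Mclass kappa M -> `|M i j| <= kappa.
Proof.
move=> [+ _]; apply: le_trans; rewrite mx_normrE.
exact: (le_bigmax _ (fun ij : 'I_n * 'I_p => `|M ij.1 ij.2|) (i, j)).
Qed.

(** * Events of the estimator *)

(** The inequality is multiplied by the denominator, and the points where the
denominator vanishes, where the ratio is 0, are treated apart. *)
Lemma measurable_ratio_event (R : realType) d (S : measurableType d)
    (num den : S -> R) (c m : R) :
  measurable_fun setT num -> measurable_fun setT den ->
  measurable [set x | c < `|num x / den x - m|].
Proof.
move=> mnum mden.
rewrite (_ : [set x | _] =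
   ([set x | den x <= 0] `&` [set x | 0 <= den x] `&` [set x | c < `|m|]) `|`
   (([set x | 0 < den x] `|` [set x | den x < 0]) `&`
    [set x | c * `|den x| < `|num x - m * den x|])).
  have mabs (f : S -> R) : measurable_fun setT f -> measurable_fun setT (fun x => `|f x|).
    exact: measurable_abs.
  apply: measurableU; apply: measurableI.
  - by apply: measurableI; exact: measurable_set_le.
  - exact: measurable_set_lt.
  - by apply: measurableU; exact: measurable_set_lt.
  - apply: measurable_set_lt; first by apply: measurable_funM => //; exact: mabs.
    by apply: mabs; apply: measurable_funB => //; exact: measurable_funM.
have key x : den x != 0 ->
    (c < `|num x / den x - m|) = (c * `|den x| < `|num x - m * den x|).
  move=> d0; rewrite -[RHS](ltr_pM2r (_ : 0 < `|den x|^-1)) ?invr_gt0 ?normr_gt0//.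
  rewrite mulfK ?normr_eq0// -normfV -normrM; congr (_ < `|_|).
  by field.
apply/seteqP; split => x /=.
  have [d0|d0] := eqVneq (den x) 0.
    by rewrite d0 invr0 mulr0 sub0r normrN; left.
  rewrite key// => H; right; split=> //.
  by case: (ltgtP (den x) 0) d0 => //; [right|left].
move=> [[[d1 d2] H]|[H]].
  have d0 : den x = 0 by apply/le_anti; rewrite d1 d2.
  by rewrite d0 invr0 mulr0 sub0r normrN.
by rewrite -key//; case: H => [/gt_eqF->|/lt_eqF->].
Qed.

Lemma measurable_mx_comp (R : realType) d (S : measurableType d) n p q r
    (f : 'M[R]_(n, p) -> 'M[R]_(q, r)) (g : S -> 'M[R]_(n, p)) i j :
  mx_measurable f -> (forall i j, measurable_fun setT (fun x => g x i j)) ->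
  measurable_fun setT (fun x => f (g x) i j).
Proof.
move=> mf mg; apply: (measurableT_comp (mf i j)).
exact: (@measurable_mx R _ S n p g).
Qed.

Lemma MhatE (R : realType) n T (Lhat : 'M[R]_(n, T.-1) -> 'cV[R]_n) i0 t0
    (X : 'M[R]_(n, T)) :
  Mhat Lhat i0 t0 X =
  let l := Lhat (col' t0 X) in
  l i0 0 * dot (row' i0 l) (row' i0 (col t0 X)) / dot (row' i0 l) (row' i0 l).
Proof.
by rewrite /Mhat dotE; congr (_ / _); apply: eq_bigr => i _; rewrite expr2.
Qed.

Lemma measurable_Mhat_event (R : realType) d (S : measurableType d) n T
    (Lhat : 'M[R]_(n, T.-1) -> 'cV[R]_n) i0 t0 (X : S -> 'M[R]_(n, T)) (c m : R) :
  mx_measurable Lhat -> (forall i j, measurable_fun setT (fun x => X x i j)) ->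
  measurable [set x | c < `|Mhat Lhat i0 t0 (X x) - m|].
Proof.
move=> mL mX.
have mL' i : measurable_fun setT (fun x => Lhat (col' t0 (X x)) i 0).
  apply: (measurable_mx_comp (g := fun x => col' t0 (X x))) => // i' j'.
  by under eq_fun do rewrite mxE; exact: mX.
under eq_set do rewrite MhatE /=.
apply: measurable_ratio_event.
  apply: measurable_funM; first exact: mL'.
  apply: measurable_sum => i; under eq_fun do rewrite !mxE.
  by apply: measurable_funM; [exact: mL'|exact: mX].
apply: measurable_sum => i; under eq_fun do rewrite !mxE.
by apply: measurable_funM; exact: mL'.
Qed.

Lemma sum_row_set (R : realType) n T (i0 : 'I_n) (f : 'I_n * 'I_T -> R) :
  \sum_(k in [set k : 'I_n * 'I_T | k.1 == i0]%SET) f k = \sum_t f (i0, t).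
Proof.
rewrite (eq_bigl (fun k : 'I_n * 'I_T => (k.1 == i0) && xpredT k.2)); last first.
  by move=> k; rewrite inE andbT.
rewrite (eq_bigr (fun k => f (k.1, k.2))); last by case.
rewrite -(pair_big (fun i => i == i0) xpredT (fun i t => f (i, t)))/=.
by rewrite big_pred1_eq.
Qed.

Lemma sum_col_set (R : realType) n T (t0 : 'I_T) (f : 'I_n * 'I_T -> R) :
  \sum_(k in [set k : 'I_n * 'I_T | k.2 == t0]%SET) f k = \sum_i f (i, t0).
Proof.
rewrite (eq_bigl (fun k : 'I_n * 'I_T => xpredT k.1 && (k.2 == t0))); last first.
  by move=> k; rewrite inE.
rewrite (eq_bigr (fun k => f (k.1, k.2))); last by case.
rewrite -(pair_big xpredT (fun t => t == t0) (fun i t => f (i, t)))/=.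
by apply: eq_bigr => i _; rewrite big_pred1_eq.
Qed.

Section noise.
Context {R : realType} {d : measure_display} {Omega : measurableType d}
  (P : probability Omega R) {n T : nat} (u : 'I_n -> 'I_T -> {RV P >-> R})
  (iid : iid_std_normal u) (M : 'M[R]_(n, T)) (i0 : 'I_n) (t0 : 'I_T)
  (Lhat : 'M[R]_(n, T.-1) -> 'cV[R]_n) (mL : mx_measurable Lhat).
Let U w : 'M[R]_(n, T) := \matrix_(i, t) u i t w.
Let W (A : 'M[R]_(n, T)) := col' t0 (M + A).

Let mW i j : measurable_fun setT (fun A : mxspace R n T => W A i j).
Proof.
rewrite /W; under eq_fun do rewrite !mxE.
by apply: measurable_funD => //; exact: measurable_entry.
Qed.

(** The loading is computed from the other columns, so it is independent of the noise in
the column t0. *)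
Lemma loading_noise_tail K : 0 <= K ->
  (P [set w | let l := Lhat (W (U w)) in
    (K * nrm (row' i0 l) < `|dot (row' i0 l) (row' i0 (col t0 (U w)))|)%R] <=
   (2 * expR (- (K ^+ 2 / 2)))%:E)%E.
Proof.
move=> K0; pose J : {set 'I_n * 'I_T} := [set k | k.2 == t0]%SET.
pose c (k : 'I_n * 'I_T) (A : mxspace R n T) : R :=
  if k.1 == i0 then 0 else Lhat (W A) k.1 0.
have mc k : measurable_fun setT (c k).
  rewrite /c; case: (k.1 == i0) => //.
  by apply: (measurable_mx_comp (S := mxspace R n T) (g := W)).
have maskW w : W (mask (~: J) (U w)) = W (U w).
  apply/matrixP => i j; rewrite !mxE !inE/=.
  by rewrite eq_sym (negbTE (neq_lift _ _)).
have := gauss_tail_random J iid K0 mc.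
rewrite /= -/(U _); congr (P _ <= _)%E; apply: eq_set => w /=; rewrite -/(U w).
rewrite !sum_col_set !(bigD1_ord i0)//= /c/= eqxx expr0n mul0r !add0r maskW.
rewrite /nrm /dot; congr (is_true (_ < _)); [congr (_ * Num.sqrt _)|congr (`|_|)].
  by apply: eq_bigr => i _; rewrite !mxE eq_sym (negbTE (neq_lift _ _)) expr2.
by apply: eq_bigr => i _; rewrite !mxE eq_sym (negbTE (neq_lift _ _)).
Qed.

(** The matrix with row i0 zeroed is independent of the noise in row i0. *)
Lemma left_out_row_noise_tail K : 0 <= K ->
  (P [set w | let B := zero_row i0 (W (U w)) in let r0 := B^T *m Lhat B in
    (K * nrm r0 < `|dot (row i0 (col' t0 (U w)))^T r0|)%R] <=
   (2 * expR (- (K ^+ 2 / 2)))%:E)%E.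
Proof.
move=> K0; pose J : {set 'I_n * 'I_T} := [set k | k.1 == i0]%SET.
pose r0 A : 'cV[R]_T.-1 := (zero_row i0 (W A))^T *m Lhat (zero_row i0 (W A)).
pose c (k : 'I_n * 'I_T) (A : mxspace R n T) : R :=
  if unlift t0 k.2 is Some j then r0 A j 0 else 0.
have mB i j : measurable_fun setT (fun A : mxspace R n T => zero_row i0 (W A) i j).
  under eq_fun do rewrite mxE.
  by case: (i == i0); [exact: measurable_cst|exact: mW].
have mc k : measurable_fun setT (c k).
  rewrite /c; case: (unlift t0 k.2) => // j.
  under eq_fun do rewrite mxE.
  apply: measurable_sum => i; apply: measurable_funM.
    by under eq_fun do rewrite mxE; exact: mB.
  by apply: (measurable_mx_comp (S := mxspace R n T) (g := fun A => zero_row i0 (W A))).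
have maskW w : zero_row i0 (W (mask (~: J) (U w))) = zero_row i0 (W (U w)).
  apply/matrixP => i j; rewrite !mxE !inE/=.
  by case: ifP => // ->.
have r0E w : r0 (mask (~: J) (U w)) = r0 (U w) by rewrite /r0 maskW.
have := gauss_tail_random J iid K0 mc.
rewrite /= -/(U _); congr (P _ <= _)%E; apply: eq_set => w /=; rewrite -/(U w).
rewrite !sum_row_set !(bigD1_ord t0)//= /c/= unlift_none expr0n mul0r !add0r r0E.
rewrite -/(r0 (U w)) /nrm /dot; congr (is_true (_ < _)); [congr (_ * Num.sqrt _)|congr (`|_|)].
  by apply: eq_bigr => j _; rewrite liftK expr2.
by apply: eq_bigr => j _; rewrite liftK !mxE mulrC.
Qed.

End noise.

(** * Large dimensions *)

Lemma sum_sqr_le (R : realType) n (x : 'cV[R]_n) (b : R) m :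
  0 <= b -> (n <= m)%N -> (forall i, `|x i 0| <= b) -> dot x x <= b ^+ 2 * m%:R.
Proof.
move=> b0 nm xb; apply: (@le_trans _ _ (\sum_(i < n) b ^+ 2)).
  apply: ler_sum => i _; rewrite -expr2 -real_normK ?num_real//.
  by rewrite lerXn2r ?nnegrE.
by rewrite sumr_const card_ord -[_ *+ n]mulr_natr ler_wpM2l ?sqr_ge0// ler_nat.
Qed.

Lemma opnorm_col' (R : realType) n p (t0 : 'I_p) (E : 'M[R]_(n, p)) eps :
  opnorm_le E eps -> opnorm_le (col' t0 E) eps.
Proof.
move=> H x y; pose z : 'cV[R]_p := \col_t if unlift t0 t is Some j then y j 0 else 0.
have zy : row' t0 z = y by apply/colP => j; rewrite !mxE liftK.
have z0 : z t0 0 = 0 by rewrite mxE unlift_none.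
have -> : col' t0 E *m y = E *m z.
  apply/colP => i; rewrite !mxE (bigD1_ord t0)//= z0 mulr0 add0r.
  by apply: eq_bigr => j _; rewrite -zy !mxE.
have -> : nrm y = nrm z by rewrite /nrm (dot_split t0 z) z0 mulr0 add0r zy.
exact: H.
Qed.

(** Consequences of the lower bound on tau: one row or one column of M carries a small
share of its norm, because the entries are at most kappa, and the noise is dominated
by the signal. *)
Lemma signal_bounds (R : realType) n T (a : 'cV[R]_n) (G : 'cV[R]_T) i0 t0
    (kappa tau : R) :
  0 < kappa -> nrm a = 1 -> tau <= nrm G ->
  (forall i t, `|(a *m G^T) i t| <= kappa) ->
  4 * Num.max (Num.sqrt 10 * kappa) 2 * Num.sqrt (3 * (n + T)%:R) <= tau ->
  0 < tau ->
  let s := nrm (row' t0 G) in let N := Num.sqrt (n + T)%:R in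
  [/\ 4 / 5 * tau <= s, 5 * N <= 3 / 8 * s, `|a i0 0| * s <= kappa * N,
      kappa * N <= s / 20 & `|G t0 0| <= kappa * N].
Proof.
move=> k0 a1 tauG Mk tau_ge tau0 s N.
have ME i t : (a *m G^T) i t = a i 0 * G t 0 by rewrite mxE big_ord1 mxE.
have N2 : N ^+ 2 = (n + T)%:R by rewrite sqr_sqrtr.
have N0 : 0 <= N by exact: sqrtr_ge0.
have s0 : 0 <= s by exact: nrm_ge0.
have kN0 : 0 <= kappa * N by rewrite mulr_ge0// ltW.
have g_le : `|G t0 0| <= kappa * N.
  rewrite -[`|_|]mulr1 -a1 -nrmZ; apply: ler_of_sqr => //.
  rewrite nrm_sqr exprMn N2; apply: sum_sqr_le; rewrite ?(ltW k0)//.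
    by rewrite leq_addr.
  by move=> i; rewrite mxE mulrC -ME.
have as_le : `|a i0 0| * s <= kappa * N.
  rewrite -nrmZ; apply: ler_of_sqr => //.
  rewrite nrm_sqr exprMn N2; apply: sum_sqr_le; rewrite ?(ltW k0)//.
    by rewrite (leq_trans (leq_pred _))// leq_addl.
  by move=> j; rewrite !mxE -ME.
have s2 : tau ^+ 2 - (kappa * N) ^+ 2 <= s ^+ 2.
  rewrite lerBlDr; apply: (@le_trans _ _ (nrm G ^+ 2)).
    by rewrite lerXn2r ?nnegrE ?nrm_ge0 ?(ltW tau0).
  rewrite !nrm_sqr (dot_split t0 G) addrC lerD2l -expr2 -real_normK ?num_real//.
  by rewrite lerXn2r ?nnegrE.
(* The constants 480 = 16 * 3 * 10 and 192 = 16 * 3 * 4 below are those of the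
   square of the signal threshold. *)
have tau_sqr x : 0 <= x -> x <= Num.max (Num.sqrt 10 * kappa) 2 ->
    48 * x ^+ 2 * N ^+ 2 <= tau ^+ 2.
  move=> x0 xmax.
  apply: (@le_trans _ _ ((4 * x * Num.sqrt (3 * (n + T)%:R)) ^+ 2)).
    by rewrite N2 exprMn sqr_sqrtr ?mulr_ge0// (_ : _ ^+ 2 * _ = 48 * x ^+ 2 * (n + T)%:R) //; ring.
  rewrite lerXn2r ?nnegrE ?(ltW tau0) ?mulr_ge0 ?sqrtr_ge0//.
  by apply: le_trans tau_ge; rewrite ler_wpM2r ?sqrtr_ge0// ler_wpM2l.
have tau_kappa : 480 * (kappa * N) ^+ 2 <= tau ^+ 2.
  have := tau_sqr (Num.sqrt 10 * kappa); rewrite le_max lexx => /(_ _ isT).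
  rewrite exprMn sqr_sqrtr// => H.
  by apply: le_trans (H _); [rewrite exprMn; lra|rewrite mulr_ge0 ?sqrtr_ge0 ?ltW].
have tau_N : 192 * N ^+ 2 <= tau ^+ 2.
  have := tau_sqr 2; rewrite le_max lexx orbT => /(_ _ isT) H.
  by apply: le_trans (H _) => //; lra.
split => //.
- apply: ler_of_sqr => //; rewrite exprMn.
  by have := sqr_ge0 tau; lra.
- apply: ler_of_sqr; first by rewrite mulr_ge0.
  by rewrite !exprMn; have := sqr_ge0 (kappa * N); lra.
- apply: ler_of_sqr; first by rewrite divr_ge0.
  by rewrite expr_div_n; have := sqr_ge0 (kappa * N); lra.
Qed.

(** The bound that is good for large n + T: outside three unlikely events the
deterministic error bound applies. *)
Lemma Mhat_error_tail (R : realType) (kappa tau K C : R) (n T : nat)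
    (d : measure_display) (Omega : measurableType d) (P : probability Omega R)
    (u : 'I_n -> 'I_T -> {RV P >-> R}) (M : 'M[R]_(n, T))
    (Lhat : 'M[R]_(n, T.-1) -> 'cV[R]_n) (i0 : 'I_n) (t0 : 'I_T) :
  0 < kappa -> 0 < tau ->
  4 * Num.max (Num.sqrt 10 * kappa) 2 * Num.sqrt (3 * (n + T)%:R) <= tau ->
  pca_estimator Lhat -> iid_std_normal u -> Mclass_tau kappa tau M ->
  0 <= K -> 4 * (4 * K * kappa + 35 * kappa + 5 * K) <= C ->
  (P [set w | C * Num.sqrt (n + T)%:R / tau <
        `|Mhat Lhat i0 t0 (M + \matrix_(i, t) u i t w) - M i0 t0| ]%R <=
   ((128 * expR (-5)) ^+ (n + T) + 4 * expR (- (K ^+ 2 / 2)))%:E)%E.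
Proof.
move=> k0 tau0 tau_ge [mL loadL] iid MM K0 C_ge.
have [a [G [ME a1 tauG]]] := Mclass_tau_rank_one tau0 MM.
have Mk i t : `|M i t| <= kappa by apply: Mclass_entry; case: MM.
have n0 : (0 < n)%N by apply: leq_ltn_trans (ltn_ord i0).
have T0 : (0 < T)%N by apply: leq_ltn_trans (ltn_ord t0).
have [B [mB PB opB]] := gaussian_opnorm iid n0 T0.
pose U w : 'M[R]_(n, T) := \matrix_(i, t) u i t w.
set N := Num.sqrt (n + T)%:R.
have mU i j : measurable_fun setT (fun w => (M + U w) i j).
  under eq_fun do rewrite !mxE.
  by apply: measurable_funD.
have mU' i j : measurable_fun setT (fun w => col' t0 (M + U w) i j).
  by under eq_fun do rewrite mxE; exact: mU.
pose B2 := [set w | let l := Lhat (col' t0 (M + U w)) in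
    K * nrm (row' i0 l) < `|dot (row' i0 l) (row' i0 (col t0 (U w)))|].
pose B3 := [set w | let B := zero_row i0 (col' t0 (M + U w)) in
    let r0 := B^T *m Lhat B in
    K * nrm r0 < `|dot (row i0 (col' t0 (U w)))^T r0|].
have PB2 : (P B2 <= (2 * expR (- (K ^+ 2 / 2)))%:E)%E.
  exact: loading_noise_tail.
have PB3 : (P B3 <= (2 * expR (- (K ^+ 2 / 2)))%:E)%E.
  exact: left_out_row_noise_tail.
have mdot p (f g : Omega -> 'cV[R]_p) :
    (forall i, measurable_fun setT (fun w => f w i 0)) ->
    (forall i, measurable_fun setT (fun w => g w i 0)) ->
    measurable_fun setT (fun w => dot (f w) (g w)).
  by move=> mf mg; apply: measurable_sum => i; exact: measurable_funM.
have mnrm p (f : Omega -> 'cV[R]_p) :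
    (forall i, measurable_fun setT (fun w => f w i 0)) ->
    measurable_fun setT (fun w => nrm (f w)).
  move=> mf; apply: (measurableT_comp (f := @Num.sqrt R)); last exact: mdot.
  exact: continuous_measurable_fun (@sqrt_continuous R).
have mB2 : measurable B2.
  have ml i : measurable_fun setT
      (fun w => row' i0 (Lhat (col' t0 (M + U w))) i 0).
    under eq_fun do rewrite mxE.
    by apply: (measurable_mx_comp (g := fun w => col' t0 (M + U w))).
  apply: measurable_set_lt; first by apply: measurable_funM => //; exact: mnrm.
  apply: measurable_abs; apply: mdot => // i.
  by under eq_fun do rewrite !mxE; exact: measurable_funPT.
have mB3 : measurable B3.
  have mZ i j : measurable_fun setT (fun w => zero_row i0 (col' t0 (M + U w)) i j).
    under eq_fun do rewrite mxE.
    by case: (i == i0); [exact: measurable_cst|exact: mU'].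
  have mr j : measurable_fun setT (fun w =>
      ((zero_row i0 (col' t0 (M + U w)))^T *m
        Lhat (zero_row i0 (col' t0 (M + U w)))) j 0).
    under eq_fun do rewrite mxE.
    apply: measurable_sum => i; apply: measurable_funM.
      by under eq_fun do rewrite mxE; exact: mZ.
    by apply: (measurable_mx_comp (g := fun w => zero_row i0 (col' t0 (M + U w)))).
  apply: measurable_set_lt; first by apply: measurable_funM => //; exact: mnrm.
  apply: measurable_abs; apply: mdot => // j.
  by under eq_fun do rewrite !mxE; exact: measurable_funPT.
apply: (@le_trans _ _ (P (B `|` (B2 `|` B3)))); last first.
  apply: le_trans (measureU2 _ _ _) _ => //; first exact: measurableU.
  rewrite EFinD; apply: leeD => //.
  apply: le_trans (measureU2 _ _ _) _ => //.
  rewrite (_ : 4 * _ = 2 * expR (- (K ^+ 2 / 2)) + 2 * expR (- (K ^+ 2 / 2)));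
    last by ring.
  by rewrite EFinD; exact: leeD.
apply: le_measure; rewrite ?inE.
- exact: measurable_Mhat_event.
- by apply: measurableU => //; exact: measurableU.
move=> w /= err; apply: contrapT => good.
have [nB [nB2 nB3]] : ~ B w /\ ~ B2 w /\ ~ B3 w by tauto.
have Mk' i t : `|(a *m G^T) i t| <= kappa by rewrite -ME.
have [tau_s eps_s as_b b_s g_b] :=
  @signal_bounds R n T a G i0 t0 kappa tau k0 a1 tauG Mk' tau_ge tau0.
rewrite -/N in eps_s as_b b_s g_b.
set F := row' t0 G in tau_s eps_s as_b b_s.
have s0 : 0 < nrm F by apply: lt_le_trans tau_s; rewrite mulr_gt0.
have WE : col' t0 (M + U w) = a *m F^T + col' t0 (U w).
  by rewrite ME; apply/matrixP => i j; rewrite !mxE !big_ord1 !mxE.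
have xE : col t0 (M + U w) = G t0 0 *: a + col t0 (U w).
  by rewrite ME; apply/colP => i; rewrite !mxE !big_ord1 !mxE mulrC.
have N0 : 0 <= N by exact: sqrtr_ge0.
have Wl := loadL (a *m F^T + col' t0 (U w)).
have Bl0 := loadL (zero_row i0 (a *m F^T + col' t0 (U w))).
have eps0 : 0 <= 5 * N by rewrite mulr_ge0.
have Eeps := opnorm_col' t0 (opB w nB).
have gak : `|G t0 0| * `|a i0 0| <= kappa.
  by rewrite -normrM mulrC; have := Mk' i0 t0; rewrite mxE big_ord1 mxE.
have := @entry_error R n _ i0 a (col t0 (U w)) _ _ _ _ (G t0 0) _ _ _ _ _
  a1 erefl s0 eps0 Eeps eps_s Wl Bl0 K0 _ _ as_b b_s g_b gak.
rewrite -xE -WE => bound.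
move: err; rewrite MhatE /= -/(U w) [M i0 t0](_ : _ = a i0 0 * G t0 0); last first.
  by rewrite ME mxE big_ord1 mxE.
rewrite ltNge => /negP; apply; apply: le_trans (bound _ _) _.
- by rewrite leNgt; apply/negP.
- by rewrite leNgt; apply/negP.
rewrite ler_pdivrMr//.
apply: (@le_trans _ _ (C * N / tau * (4 / 5 * tau))); last first.
  by rewrite ler_wpM2l// divr_ge0 ?(ltW tau0)// mulr_ge0// (le_trans _ C_ge)//
    !(mulr_ge0, addr_ge0)// ltW.
rewrite [leRHS](_ : _ = 4 / 5 * N * C); last by field; rewrite gt_eqF.
rewrite [leLHS](_ : _ = 4 / 5 * N * (4 * (4 * K * kappa + 35 * kappa + 5 * K))).
  by rewrite ler_wpM2l// mulr_ge0.
by field.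
Qed.

(** * Bounded dimensions *)

Lemma frob_rank_one (R : realType) n p (a : 'cV[R]_n) (G : 'cV[R]_p) :
  frob (a *m G^T) = dot a a * dot G G.
Proof.
rewrite mulr_suml; apply: eq_bigr => i _.
have -> : (row i (a *m G^T))^T = a i 0 *: G.
  by apply/colP => j; rewrite !mxE big_ord1 !mxE.
by rewrite dotZl dotZr mulrA.
Qed.

Lemma frob_le (R : realType) n p (A : 'M[R]_(n, p)) b m :
  0 <= b -> (n <= m)%N -> (p <= m)%N -> (forall i j, `|A i j| <= b) ->
  frob A <= b ^+ 2 * m%:R ^+ 2.
Proof.
move=> b0 nm pm Ab; apply: (@le_trans _ _ (\sum_(i < n) b ^+ 2 * m%:R)).
  by apply: ler_sum => i _; apply: sum_sqr_le => // j; rewrite !mxE.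
rewrite sumr_const card_ord -[_ *+ n]mulr_natr expr2 mulrA.
by rewrite ler_wpM2l ?mulr_ge0 ?sqr_ge0// ler_nat.
Qed.

(** The estimated loading concentrates on the row i0 only if that row is nearly
orthogonal to the other rows. *)
Lemma loading_off_row (R : realType) n p (W : 'M[R]_(n, p)) l i0 i2 :
  pca_loading W l -> i2 != i0 ->
  `|l i0 0| * `|dot (row i0 W)^T (row i2 W)^T| <= 2 * frob W * nrm (row' i0 l).
Proof.
move=> Wl i20; have [lam [lam0 Wr lamW _]] := loading_spec Wl.
have lam_frob : lam <= frob W.
  rewrite -(ler_pM2r (dot_gt0 (proj1 Wl))).
  have -> : lam * dot l l = dot (W^T *m l) (W^T *m l).
    by rewrite -dot_mulmx Wr dotZr.
  have -> : frob W = frob W^T by rewrite !frob_trace trmxK mxtrace_mulC.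
  exact: frob_mulmx.
have Wdelta i : W^T *m delta_mx i 0 = (row i W)^T.
  by rewrite rowE trmx_mul trmx_delta.
pose y := l - l i0 0 *: delta_mx i0 0.
have y0 : y i0 0 = 0 by rewrite !mxE !eqxx mulr1 subrr.
have yl : nrm y = nrm (row' i0 l).
  rewrite /nrm (dot_split i0 y) y0 mulr0 add0r.
  have -> // : row' i0 y = row' i0 l.
  by apply/colP => i; rewrite !mxE eq_sym (negbTE (neq_lift _ _)) mulr0 subr0.
have y2 : `|l i2 0| <= nrm (row' i0 l).
  have -> : l i2 0 = dot (delta_mx i2 0) y.
    by rewrite dot_col_delta !mxE (negbTE i20) mulr0 subr0.
  by apply: le_trans (cauchy_schwarz _ _) _; rewrite nrm_delta mul1r yl.
(* The row i2 of the eigenvector equation, solved for the entry l i0. *)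
have lE : l i0 0 * dot (row i0 W)^T (row i2 W)^T =
    lam * l i2 0 - dot (row i2 W)^T (W^T *m y).
  have -> : lam * l i2 0 = dot (row i2 W)^T (W^T *m l).
    by rewrite -mulmx_dot_row Wr mxE.
  rewrite -dotBr -mulmxBr /y opprB addrC subrK -scalemxAr dotZr Wdelta.
  by rewrite (dotC (row i2 W)^T).
have W_le x : nrm (W^T *m x) <= Num.sqrt lam * nrm x.
  by rewrite -sqrtrM// ler_wsqrtr.
rewrite -normrM lE; apply: le_trans (ler_normB _ _) _.
apply: (@le_trans _ _ (lam * nrm (row' i0 l) + lam * nrm (row' i0 l))); last first.
  rewrite [leLHS](_ : _ = 2 * lam * nrm (row' i0 l)); last by ring.
  by rewrite ler_wpM2r ?nrm_ge0// ler_wpM2l.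
apply: lerD; first by rewrite normrM ger0_norm// ler_wpM2l.
apply: le_trans (cauchy_schwarz _ _) _.
rewrite -yl -[in leRHS](sqr_sqrtr lam0) expr2 -mulrA; apply: ler_pM; rewrite ?nrm_ge0//.
by rewrite -Wdelta; have := W_le (delta_mx i2 0); rewrite nrm_delta mulr1.
Qed.

Lemma Mhat_le (R : realType) n T (Lhat : 'M[R]_(n, T.-1) -> 'cV[R]_n) i0 i2 t0
    (X : 'M[R]_(n, T)) (c gam : R) m :
  pca_estimator Lhat -> i2 != i0 -> 0 <= c -> 0 < gam -> (n + T <= m)%N ->
  (forall i t, `|X i t| <= c) ->
  gam <= `|dot (row i0 (col' t0 X))^T (row i2 (col' t0 X))^T| ->
  `|Mhat Lhat i0 t0 X| <= 2 * c ^+ 3 * m%:R ^+ 3 / gam.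
Proof.
move=> [_ loadL] i20 c0 gam0 nTm Xc gamX; rewrite MhatE /=.
set W := col' t0 X in gamX *; set l := Lhat W; set l' := row' i0 l.
have nm : (n <= m)%N by rewrite (leq_trans _ nTm)// leq_addr.
have Tm : (T.-1 <= m)%N.
  by rewrite (leq_trans (leq_pred _))// (leq_trans _ nTm)// leq_addl.
have rhs0 : 0 <= 2 * c ^+ 3 * m%:R ^+ 3 / gam.
  by rewrite divr_ge0 ?(ltW gam0)// !mulr_ge0 ?exprn_ge0.
have [l'0|l'0] := eqVneq l' 0; first by rewrite l'0 dot0r invr0 mulr0 normr0.
have m0 : 0 < nrm l' by exact: nrm_gt0.
have frobW : frob W <= c ^+ 2 * m%:R ^+ 2.
  by apply: frob_le => // i j; rewrite mxE.
have x_le : nrm (row' i0 (col t0 X)) <= c * m%:R.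
  apply: ler_of_sqr; first by rewrite mulr_ge0.
  rewrite nrm_sqr exprMn.
  apply: le_trans (sum_sqr_le c0 (_ : (_ <= m)%N) _) _.
  - by rewrite (leq_trans (leq_pred _)).
  - by move=> i; rewrite !mxE.
  rewrite ler_wpM2l ?sqr_ge0// -natrX ler_nat.
  by case: (m) => // k; rewrite expnS leq_pmulr// expn1.
have l1 : `|l i0 0| * gam <= 2 * (c ^+ 2 * m%:R ^+ 2) * nrm l'.
  apply: le_trans (ler_wpM2l (normr_ge0 _) gamX) _.
  apply: le_trans (loading_off_row (loadL W) i20) _.
  by rewrite ler_wpM2r ?nrm_ge0// ler_wpM2l.
rewrite normrM normfV normrM (ger0_norm (dot_ge0 _)) ler_pdivrMr; last exact: dot_gt0.
apply: (@le_trans _ _ (`|l i0 0| * (nrm l' * (c * m%:R)))).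
  rewrite ler_wpM2l//; apply: le_trans (cauchy_schwarz _ _) _.
  by rewrite ler_wpM2l ?nrm_ge0.
rewrite -nrm_sqr mulrAC ler_pdivlMr//.
rewrite [leLHS](_ : _ = (`|l i0 0| * gam) * (nrm l' * (c * m%:R))); last by ring.
apply: le_trans (ler_wpM2r _ l1) _.
  by rewrite !mulr_ge0// nrm_ge0.
by rewrite le_eqVlt; apply/orP; left; apply/eqP; ring.
Qed.

(** The bound used for bounded n + T, where the operator norm of the noise may be large
with a probability that is not below alpha. Here tau <= kappa * m, so only tightness of
the error is needed. The danger is a small denominator, which is excluded because two
rows of a Gaussian matrix are not nearly orthogonal. *)
Lemma Mhat_error_bounded (R : realType) (kappa tau K eta C : R) (n T m : nat)
    (d : measure_display) (Omega : measurableType d) (P : probability Omega R)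
    (u : 'I_n -> 'I_T -> {RV P >-> R}) (M : 'M[R]_(n, T))
    (Lhat : 'M[R]_(n, T.-1) -> 'cV[R]_n) (i0 i2 : 'I_n) (t0 : 'I_T)
    (j2 : 'I_T.-1) :
  0 < kappa -> 0 < tau -> pca_estimator Lhat -> iid_std_normal u ->
  Mclass_tau kappa tau M -> i2 != i0 -> (n + T <= m)%N -> 0 <= K -> 0 < eta ->
  (2 * (kappa + K) ^+ 3 * m%:R ^+ 3 / eta ^+ 2 + kappa) * (kappa * m%:R) <= C ->
  (P [set w | C * Num.sqrt (n + T)%:R / tau <
        `|Mhat Lhat i0 t0 (M + \matrix_(i, t) u i t w) - M i0 t0| ]%R <=
   (m%:R ^+ 2 * (2 * expR (- (K ^+ 2 / 2))) + 2 * eta)%:E)%E.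
Proof.
move=> k0 tau0 estL iid MM i20 nTm K0 eta0 C_ge.
have mL := pca_estimator_measurable estL.
have [a [G [ME a1 tauG]]] := Mclass_tau_rank_one tau0 MM.
have Mk i t : `|M i t| <= kappa by apply: Mclass_entry; case: MM.
have nm : (n <= m)%N by rewrite (leq_trans _ nTm)// leq_addr.
have Tm : (T <= m)%N by rewrite (leq_trans _ nTm)// leq_addl.
pose U w : 'M[R]_(n, T) := \matrix_(i, t) u i t w.
have mU i j : measurable_fun setT (fun w => (M + U w) i j).
  under eq_fun do rewrite !mxE.
  by apply: measurable_funD.
have tau_le : tau <= kappa * m%:R.
  apply: le_trans tauG _; apply: ler_of_sqr; first by rewrite mulr_ge0// ltW.
  rewrite nrm_sqr exprMn; have := @frob_rank_one R _ _ a G.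
  by rewrite -nrm_sqr a1 expr1n mul1r -ME => <-; apply: frob_le; rewrite ?(ltW k0).
pose t2 := lift t0 j2.
pose A1k (k : 'I_n * 'I_T) := [set w | K * Num.sqrt (\sum_(j in [set k]%SET) 1 ^+ 2) <
       `|\sum_(j in [set k]%SET) 1 * u j.1 j.2 w|].
have A1kE k w : A1k k w = (K < `|u k.1 k.2 w|) :> Prop.
  by rewrite /A1k/= !big_set1 expr1n sqrtr1 mulr1 mul1r.
have [mA1 PA1] : measurable [set w | exists2 k, k \in enum [set: 'I_n * 'I_T]%SET & A1k k w] /\
   (P [set w | exists2 k, k \in enum [set: 'I_n * 'I_T]%SET & A1k k w] <=
     ((size (enum [set: 'I_n * 'I_T]%SET))%:R * (2 * expR (- (K ^+ 2 / 2))))%:E)%E.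
  apply: finite_union_bound => k _; split.
    rewrite (_ : A1k k = [set w | K < `|u k.1 k.2 w|]); last first.
      by apply/seteqP; split => w; rewrite A1kE.
    by apply: measurable_set_lt => //; exact: measurable_abs.
  exact: gauss_tail_abs.
set A1 := [set w | exists2 k, _ & _] in mA1 PA1.
have {}PA1 : (P A1 <= (m%:R ^+ 2 * (2 * expR (- (K ^+ 2 / 2))))%:E)%E.
  apply: le_trans PA1 _; rewrite lee_fin ler_wpM2r ?mulr_ge0 ?expR_ge0//.
  rewrite -cardE cardsT card_prod !card_ord -natrX ler_nat.
  by rewrite expnS expn1 leq_mul.
pose A2 := [set w | `|u i0 t2 w + M i0 t2| <= eta].
have PA2 : (P A2 <= eta%:E)%E by apply: normal_small_ball => //; exact: ltW.
have mA2 : measurable A2.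
  by apply: measurable_set_le => //; apply: measurable_abs; exact: measurable_funD.
(* As a function of the single entry u i2 t2 alone, the inner product of the
   rows i0 and i2 is affine with slope f, the entry (i0, t2) of the data. *)
pose f (A : mxspace R n T) : R := (M + A) i0 t2.
pose h (A : mxspace R n T) : R := f A * M i2 t2 +
  \sum_(j < T.-1 | j != j2) (M + A) i0 (lift t0 j) * (M + A) i2 (lift t0 j).
pose A3 := [set w | let A := mask (~: [set (i2, t2)]) (U w) in
      (eta < `|f A|) && (`|f A * u i2 t2 w + h A| <= eta ^+ 2)].
have mMA i j : measurable_fun setT (fun A : mxspace R n T => (M + A) i j).
  under eq_fun do rewrite mxE.
  by apply: measurable_funD => //; exact: measurable_entry.
have mf : measurable_fun setT f by exact: mMA.
have mh : measurable_fun setT h.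
  apply: measurable_funD; first exact: measurable_funM.
  under eq_fun do rewrite big_mkcond/=.
  apply: measurable_sum => j; case: (j != j2); last exact: measurable_cst.
  exact: measurable_funM.
have PA3 : (P A3 <= eta%:E)%E by exact: small_ball_random.
have mA3 : measurable A3.
  have [X XE] := mask_mfun u (~: [set (i2, t2)]).
  rewrite (_ : A3 = [set w | eta < `|f (X w)|] `&`
      [set w | `|f (X w) * u i2 t2 w + h (X w)| <= eta ^+ 2]); last first.
    by rewrite XE; apply/seteqP; split => w /= /andP.
  have mX (g : mxspace R n T -> R) : measurable_fun setT g ->
      measurable_fun setT (fun w => g (X w)).
    by move=> mg; exact: (measurableT_comp mg).
  apply: measurableI.
    by apply: measurable_set_lt => //; apply: measurable_abs; exact: mX.
  apply: measurable_set_le => //; apply: measurable_abs.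
  apply: measurable_funD; last exact: mX.
  by apply: measurable_funM => //; exact: mX.
have keep w i t : (i, t) != (i2, t2) ->
    (M + mask (~: [set (i2, t2)]) (U w)) i t = (M + U w) i t.
  by move=> it; rewrite !mxE !inE it.
have gram w : f (mask (~: [set (i2, t2)]) (U w)) * u i2 t2 w +
    h (mask (~: [set (i2, t2)]) (U w)) =
    dot (row i0 (col' t0 (M + U w)))^T (row i2 (col' t0 (M + U w)))^T.
  have i02 t : (i0, t) != (i2, t2) by rewrite xpair_eqE eq_sym (negbTE i20).
  have entry i j : (row i (col' t0 (M + U w)))^T j 0 = (M + U w) i (lift t0 j).
    by rewrite !mxE.
  rewrite /h /f keep// /dot [RHS](bigD1 j2)//= !entry -/t2 addrA -mulrDr.
  have -> : u i2 t2 w + M i2 t2 = (M + U w) i2 t2 by rewrite !mxE addrC.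
  congr (_ + _); apply: eq_bigr => j jj2; rewrite !entry !keep//.
  by rewrite xpair_eqE eqxx /t2 (inj_eq lift_inj).
apply: (@le_trans _ _ (P (A1 `|` (A2 `|` A3)))); last first.
  apply: le_trans (measureU2 _ _ _) _ => //; first exact: measurableU.
  rewrite EFinD; apply: leeD => //.
  apply: le_trans (measureU2 _ _ _) _ => //.
  by rewrite mulr_natl mulr2n EFinD; exact: leeD.
apply: le_measure; rewrite ?inE.
- exact: measurable_Mhat_event.
- by apply: measurableU => //; exact: measurableU.
move=> w /= err; apply: contrapT => good.
have [nA1 [nA2 nA3]] : ~ A1 w /\ ~ A2 w /\ ~ A3 w by tauto.
have Xc i t : `|(M + U w) i t| <= kappa + K.
  rewrite !mxE; apply: le_trans (ler_normD _ _) _; apply: lerD => //.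
  rewrite leNgt; apply/negP => Ku; apply: nA1; exists (i, t).
    by rewrite mem_enum inE.
  by rewrite A1kE.
have far : eta ^+ 2 <=
    `|dot (row i0 (col' t0 (M + U w)))^T (row i2 (col' t0 (M + U w)))^T|.
  rewrite -gram leNgt; apply/negP => small; apply: nA3; rewrite /A3/= (ltW small) andbT.
  rewrite ltNge; apply/negP => f_small; apply: nA2; rewrite /A2/=.
  apply: le_trans f_small; rewrite /f keep; last first.
    by rewrite xpair_eqE eq_sym (negbTE i20).
  by rewrite !mxE addrC.
have cK : 0 <= kappa + K by rewrite addr_ge0// ltW.
have Mhat_bound := Mhat_le estL i20 cK (exprn_gt0 2 eta0) nTm Xc far.
move: err; rewrite -/(U w) ltNge => /negP; apply.
apply: le_trans (ler_normB _ _) _; apply: le_trans (lerD Mhat_bound (Mk i0 t0)) _.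
set D := _ + kappa in C_ge *.
have D0 : 0 <= D.
  by rewrite addr_ge0 ?(ltW k0)// !mulr_ge0 ?exprn_ge0// invr_ge0 exprn_ge0// ltW.
have N1 : 1 <= Num.sqrt (n + T)%:R :> R.
  rewrite -[leLHS]sqrtr1 ler_wsqrtr// ler1n.
  by rewrite (leq_trans _ (leq_addr T n))// (leq_trans _ (ltn_ord i0)).
rewrite ler_pdivlMr//.
apply: (@le_trans _ _ (D * (kappa * m%:R))); first by rewrite ler_wpM2l.
have C0 : 0 <= C by apply: le_trans (C_ge); rewrite !mulr_ge0// ltW.
by apply: le_trans C_ge _; rewrite ler_peMr.
Qed.

(** * The uniform bound *)

(** Lower bounds on expR by repeated squaring. *)
Lemma expR_doubling (R : realType) (x a b : R) :
  0 <= a -> a <= expR x -> b <= a ^+ 2 -> b <= expR (x * 2).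
Proof.
move=> a0 ax /le_trans; apply.
by rewrite mulr_natr mulr2n expRD -expr2 lerXn2r// nnegrE expR_ge0.
Qed.

Lemma expR5_gt (R : realType) : 128 < expR 5 :> R.
Proof.
have e0 : 1 + 5 / 128 <= expR (5 / 128) :> R by exact: expR_ge1Dx.
have e1 : 122 / 113 <= expR (5 / 128 * 2) :> R.
  by apply: expR_doubling e0 _; lra.
have e2 : 134 / 115 <= expR (5 / 128 * 2 * 2) :> R.
  by apply: expR_doubling e1 _; lra.
have e3 : 19 / 14 <= expR (5 / 128 * 2 * 2 * 2) :> R.
  by apply: expR_doubling e2 _; lra.
have e4 : 186 / 101 <= expR (5 / 128 * 2 * 2 * 2 * 2) :> R.
  by apply: expR_doubling e3 _; lra.
have e5 : 78 / 23 <= expR (5 / 128 * 2 * 2 * 2 * 2 * 2) :> R.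
  by apply: expR_doubling e4 _; lra.
have e6 : 23 / 2 <= expR (5 / 128 * 2 * 2 * 2 * 2 * 2 * 2) :> R.
  by apply: expR_doubling e5 _; lra.
have e7 : 132 <= expR (5 / 128 * 2 * 2 * 2 * 2 * 2 * 2 * 2) :> R.
  by apply: expR_doubling e6 _; lra.
have x7 : 5 / 128 * 2 * 2 * 2 * 2 * 2 * 2 * 2 = 5 :> R by field.
by rewrite x7 in e7; apply: lt_le_trans e7; lra.
Qed.

Lemma expRN_le (R : realType) (x : R) : 0 < x -> expR (- x) <= x^-1.
Proof.
move=> x0; rewrite expRN lef_pV2 ?posrE ?expR_gt0//.
by apply: le_trans (expR_ge1Dx _); rewrite lerDr.
Qed.

Theorem theorem2 (R : realType) (kappa alpha : R) (kappa_gt0 : 0 < kappa)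
    (alpha_gt0 : 0 < alpha) (alpha_lt1 : alpha < 1) :
  exists2 C : R, 0 < C &
  forall (n T : nat) (hn : (2 <= n)%N) (hT : (2 <= T)%N) (tau : R),
    4 * Num.max (Num.sqrt 10 * kappa) 2 * Num.sqrt (3 * (n + T)%:R) <= tau ->
  forall Lhat : 'M[R]_(n, T.-1) -> 'cV[R]_n, pca_estimator Lhat ->
  forall (d : measure_display) (Omega : measurableType d)
    (P : probability Omega R) (u : 'I_n -> 'I_T -> {RV P >-> R}),
    iid_std_normal u ->
  let i1 : 'I_n := Ordinal (ltnW hn) in
  let t1 : 'I_T := Ordinal (ltnW hT) in
  (ereal_sup
     [set P [set w | C * Num.sqrt (n + T)%:R / tau <
                     `| Mhat Lhat i1 t1 (M + \matrix_(i, t) u i t w)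
                        - M i1 t1 |]%R
     | M in (Mclass_tau kappa tau : set 'M[R]_(n, T))] <= alpha%:E)%E.
Proof.
pose q : R := 128 * expR (-5).
have q0 : 0 <= q by rewrite mulr_ge0// expR_ge0.
have q1 : q < 1 by rewrite /q expRN ltr_pdivrMr ?expR_gt0// mul1r expR5_gt.
have [m m_gt0 qm] : exists2 m : nat, (0 < m)%N & q ^+ m <= alpha / 2.
  have : q ^+ k @[k --> \oo] --> (0 : R) by apply: cvg_expr; rewrite ger0_norm.
  move=> /cvgrPdist_lt /(_ (alpha / 2)); rewrite divr_gt0// => /(_ isT)[m _ H].
  exists m.+1 => //; have := H m.+1 (leqnSn m).
  by rewrite /= sub0r normrN ger0_norm ?exprn_ge0// => /ltW.
(* K1 serves the large dimensions, K2 the finitely many small ones. *)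
pose K1 : R := 4 / Num.sqrt alpha.
have K1_ge0 : 0 <= K1 by rewrite divr_ge0// sqrtr_ge0.
have K1_tail : 4 * expR (- (K1 ^+ 2 / 2)) <= alpha / 2.
  rewrite /K1 expr_div_n sqr_sqrtr ?(ltW alpha_gt0)//.
  have x0 : 0 < 4 ^+ 2 / alpha / 2 by rewrite !divr_gt0.
  apply: le_trans (ler_wpM2l _ (expRN_le x0)) _ => //.
  rewrite (_ : 4 * _ = alpha / 2)//; field; exact: lt0r_neq0.
pose K2 : R := Num.sqrt (8 * m%:R ^+ 2 / alpha).
have K2_ge0 : 0 <= K2 by exact: sqrtr_ge0.
have mR : 0 < m%:R :> R by rewrite ltr0n.
have K2_tail : m%:R ^+ 2 * (2 * expR (- (K2 ^+ 2 / 2))) <= alpha / 2.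
  have y0 : 0 < 8 * m%:R ^+ 2 / alpha by rewrite divr_gt0// mulr_gt0// exprn_gt0.
  rewrite /K2 sqr_sqrtr ?(ltW y0)//.
  have x0 : 0 < 8 * m%:R ^+ 2 / alpha / 2 by rewrite divr_gt0.
  apply: (@le_trans _ _ (m%:R ^+ 2 * (2 * (8 * m%:R ^+ 2 / alpha / 2)^-1))).
    by rewrite ler_wpM2l ?exprn_ge0// ler_wpM2l// expRN_le.
  by rewrite (_ : _ * _ = alpha / 2)//; field; rewrite !lt0r_neq0.
pose C1 := 4 * (4 * K1 * kappa + 35 * kappa + 5 * K1).
pose C2 := (2 * (kappa + K2) ^+ 3 * m%:R ^+ 3 / (alpha / 4) ^+ 2 + kappa) *
  (kappa * m%:R).
exists (Num.max C1 C2).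
  rewrite lt_max; apply/orP; left; rewrite mulr_gt0// ltr_wpDr ?mulr_ge0//.
  by rewrite ltr_wpDl ?mulr_gt0// !mulr_ge0// ltW.
move=> n T hn hT tau tau_ge Lhat estL d Omega P u iid; cbv zeta.
set i1 : 'I_n := Ordinal _; set t1 : 'I_T := Ordinal _.
have tau0 : 0 < tau.
  apply: lt_le_trans tau_ge; rewrite !mulr_gt0//.
    by rewrite lt_max ltr0n orbT.
  by rewrite sqrtr_gt0 mulr_gt0// ltr0n addn_gt0 (ltnW hn).
apply: ge_ereal_sup => _ [M MM <-].
have [mnT|nTm] := leqP m (n + T).
  apply: le_trans (Mhat_error_tail i1 t1 kappa_gt0 tau0 tau_ge estL iid MM K1_ge0 _) _.
    by rewrite le_max lexx.
  rewrite lee_fin [leRHS](splitr alpha); apply: lerD => //.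
  by apply: le_trans qm; apply: ler_wiXn2l => //; exact: ltW.
have lt1 : (1 < n)%N by [].
have j2 : 'I_T.-1 by case: T hT {t1 tau_ge Lhat estL u iid M MM nTm} => [|[|T]] // _; exact: ord0.
have eta0 : 0 < alpha / 4 by rewrite divr_gt0.
have i21 : Ordinal lt1 != i1 by [].
apply: le_trans (Mhat_error_bounded t1 j2 kappa_gt0 tau0 estL iid MM i21
  (ltnW nTm) K2_ge0 eta0 _) _.
  by rewrite le_max lexx orbT.
by rewrite lee_fin; lra.
Qed.
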